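(* Let $-1<\gamma\leq 0$, $\beta\in\mathbb{D}$, and $\psi_{\beta,1}(w)=\frac{w-\beta}{1-\bar\beta w}$ for $w\in\mathbb{D}$. For the composition operator $C_{\psi_{\beta,1}}$ on $A^2_\gamma(\mathbb{D})$, $\mathbf{Ber}(C_{\psi_{\beta,1}})$ is a convex subset of $\mathbb{C}$ if and only if $\beta=0$.
   Context: $\mathbb{D}$ is the open unit disk of $\mathbb{C}$; $dA$ is area measure on $\mathbb{D}$ normalized so that $\mathbb{D}$ has area $1$; $dA_\gamma(w)=(\gamma+1)(1-|w|^2)^\gamma dA(w)$. The weighted Bergman space $A^2_\gamma(\mathbb{D})$ is the Hilbert space of holomorphic functions $f$ on $\mathbb{D}$ with $\int_{\mathbb{D}}|f|^2dA_\gamma<\infty$, with inner product $\langle f,g\rangle=\int_{\mathbb{D}}f\bar g\,dA_\gamma$. Its normalized reproducing kernel at $\xi\in\mathbb{D}$ is $\hat k^\gamma_\xi(w)=\frac{(1-|\xi|^2)^{(\gamma+2)/2}}{(1-\bar\xi w)^{\gamma+2}}$ (principal branch of the power). For a holomorphic self-map $\psi$ of $\mathbb{D}$, the composition operator is $C_\psi f=f\circ\psi$. For a bounded linear operator $T$ on $A^2_\gamma(\mathbb{D})$, the Berezin transform is $\widetilde T(\xi)=\langle T\hat k^\gamma_\xi,\hat k^\gamma_\xi\rangle$, $\xi\in\mathbb{D}$, and the Berezin range is $\mathbf{Ber}(T)=\{\widetilde T(\xi):\xi\in\mathbb{D}\}$. *)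

(* Defs.v *)
From HB Require Import structures.
From mathcomp Require Import all_boot all_order all_algebra.
From mathcomp Require Import all_classical all_reals all_analysis.

Set Implicit Arguments.
Unset Strict Implicit.
Unset Printing Implicit Defensive.

Import Order.TTheory GRing.Theory Num.Theory.
Import numFieldNormedType.Exports.
From mathcomp Require Import complex.

Local Open Scope classical_set_scope.
Local Open Scope ring_scope.
Local Open Scope complex_scope.

Section bergman.
Context {R : realType}.
Notation C := R[i].
(* The modulus as an element of R; the norm `|z| lives in R[i]. *)
Notation normc := (@ComplexField.Normc.normc R).

Definition unit_disk : set C := [set z | `|z| < 1].

(* Principal argument, in ]-pi, pi] for z != 0. *)
Definition cArg (z : C) : R :=
  if 0 <= Im z then acos (Re z / normc z) else - acos (Re z / normc z).

(* Principal branch of z ^ a = exp (a Log z), for z != 0. *)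
Definition cpow (z : C) (a : R) : C :=
  (normc z `^ a * cos (a * cArg z)) +i* (normc z `^ a * sin (a * cArg z)).

(* C is identified with R * R, which carries the planar Lebesgue measure. *)
Definition cpt (p : R * R) : C := p.1 +i* p.2.

Definition planar_disk : set (R * R) := cpt @^-1` unit_disk.

Definition lebesgue2 := (@lebesgue_measure R \x @lebesgue_measure R)%E.

Lemma inv_disk_area_ge0 : 0 <= (fine (lebesgue2 planar_disk))^-1 :> R.
Proof. by rewrite invr_ge0 fine_ge0. Qed.

(* dA, only ever integrated over the disk, which it gives mass 1. *)
Definition area := mscale (NngNum inv_disk_area_ge0) lebesgue2.

(* The density of dA_gamma with respect to dA. *)
Definition weight (gamma : R) (z : C) : R :=
  (gamma + 1) * (1 - normc z ^+ 2) `^ gamma.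

Definition holomorphic_on (D : set C) (f : C -> C) : Prop :=
  forall z, D z -> derivable (f : C^o -> C^o) z 1.

(* \int_D f dA_gamma, for complex-valued f. *)
Definition disk_integral (gamma : R) (f : C -> C) : C :=
  (\int[area]_(p in planar_disk) (Re (f (cpt p)) * weight gamma (cpt p)))
  +i*
  (\int[area]_(p in planar_disk) (Im (f (cpt p)) * weight gamma (cpt p))).

(* Functions on the disk are represented by functions on C whose values off
   the disk are junk: membership, the inner product and composition with a
   self-map of the disk only depend on the values on the disk. *)
Definition in_bergman (gamma : R) (f : C -> C) : Prop :=
  holomorphic_on unit_disk f /\
  (\int[area]_(p in planar_disk)
     (normc (f (cpt p)) ^+ 2 * weight gamma (cpt p))%:E < +oo)%E.

Definition bergman (gamma : R) := {f : C -> C | in_bergman gamma f}.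

Definition bergman_inner (gamma : R) (f g : bergman gamma) : C :=
  disk_integral gamma (fun w => sval f w * (sval g w)^*%C).

Lemma in_bergman0 (gamma : R) : in_bergman gamma (fun=> 0).
Proof.
split; first by move=> z _; exact: derivable_cst.
rewrite integral0_eq ?ltry// => p _.
by rewrite /normc /= expr0n /= addr0 sqrtr0 expr0n mul0r.
Qed.

(* f as an element of A^2_gamma; the zero function if f is not in A^2_gamma. *)
Definition to_bergman (gamma : R) (f : C -> C) : bergman gamma :=
  match pselect (in_bergman gamma f) with
  | left fA2 => exist _ f fA2
  | right _ => exist _ _ (in_bergman0 gamma)
  end.

Definition kernel_fun (gamma : R) (xi w : C) : C :=
  ((1 - normc xi ^+ 2) `^ ((gamma + 2) / 2))%:C
  / cpow (1 - xi^*%C * w) (gamma + 2).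

(* For xi in the disk and gamma > -1, kernel_fun gamma xi is in A^2_gamma. *)
Definition normalized_kernel (gamma : R) (xi : C) : bergman gamma :=
  to_bergman gamma (kernel_fun gamma xi).

(* When psi is a holomorphic self-map of the disk and gamma > -1, C_psi is
   bounded on A^2_gamma, so f \o psi is always in A^2_gamma. *)
Definition composition_operator (gamma : R) (psi : C -> C)
    (f : bergman gamma) : bergman gamma :=
  to_bergman gamma (sval f \o psi).

Definition berezin_transform (gamma : R) (T : bergman gamma -> bergman gamma)
    (xi : C) : C :=
  bergman_inner (T (normalized_kernel gamma xi)) (normalized_kernel gamma xi).

Definition berezin_range (gamma : R) (T : bergman gamma -> bergman gamma) :
    set C :=
  berezin_transform T @` unit_disk.

Definition psi1 (beta w : C) : C := (w - beta) / (1 - beta^*%C * w).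

(* Rcomplex R is C with its R-module structure. *)
Definition cconvex (A : set C) : Prop := @convex_set R (Rcomplex R) A.

End bergman.

Arguments composition_operator {R} gamma psi f.

(* Main.v *)
Require Import Defs.
From HB Require Import structures.
From mathcomp Require Import all_boot all_order all_algebra.
From mathcomp Require Import all_classical all_reals all_analysis.
From mathcomp Require Import measurable_realfun.
From mathcomp Require Import ring lra.

Set Implicit Arguments.
Unset Strict Implicit.
Unset Printing Implicit Defensive.

Import Order.TTheory GRing.Theory Num.Theory.
Import numFieldNormedType.Exports.
From mathcomp Require Import complex.

(* The reproducing property of the kernel K at xi turns the Berezin transform
   into c0 (1 - |xi|^2)^s / q(xi)^s with s = gamma + 2, q = 1 - conj(xi) psi(xi)
   and c0 > 0 the total mass of the weight, whose value is irrelevant here.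

   Reproducing property: with rho = 1 - |w|^2 and L = (1 - conj(xi) w) K, so that
   L' = (gamma + 1) conj(xi) K, the derivative of h conj(L) rho^(gamma + 1) with
   respect to conj(w) is (gamma + 1) rho^gamma (xi - w) h conj(K) for holomorphic
   h.  By Stokes on the disks |w| < r (the boundary term is O((1 - r^2)^(gamma+1)))
   the function (w - xi) h is orthogonal to K.  Up to a uniform error O(1/n),
   f - f(xi) is (w - xi) h with h a Riemann sum of the mean of f' along the
   segment from xi to w; hence <f, K> = f(xi) <1, K>, and xi = 0 gives
   <1, K> = c0.

   Range: Re q > 0 and s <= 2, so that a real value forces q to be real, and then
   (1 - |xi|^2) / q = 1 - Re(conj(xi) beta) >= 1 - |beta|: real values are at
   least c0 (1 - |beta|)^s.  If beta <> 0, the points xi = +- i t beta / |beta|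
   yield conjugate values tending to 0 as t -> 1, and their midpoint is a real
   value that is too small. *)

Local Open Scope classical_set_scope.
Local Open Scope ring_scope.
Local Open Scope complex_scope.

(** For fixed xi and beta, 1 - conj(xi) w and 1 - conj(beta) w stay away from 0 on the whole disk,
    so all functions that occur there are bounded, with bounded derivatives. Only the weight
    degenerates at the circle: for gamma < 0 it is unbounded, and its integrability has to be
    proved. Stokes' formula itself supplies it, with h = 1 and L the identity; the boundary term,
    which must vanish in the orthogonality argument, then only has to stay bounded. The formula is
    reduced to one variable: Fubini cuts a subdisk into chords, and the fundamental theorem of
    calculus leaves on each chord only values on the circle. The mean of f' along a segment would
    call for differentiation under an integral sign; a Riemann sum is a finite sum of functions
    already controlled, at the price of an error that tends to 0. As h is built from f' and must be
    differentiable itself, test functions carry two derivatives. The points xi = +- i t beta /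
    |beta| make conj(beta) xi imaginary, which keeps q away from 0 while 1 - |xi|^2 tends to 0. *)

Notation normc := ComplexField.Normc.normc.

(** * Modulus, real and imaginary parts *)

Section complex_modulus.
Context {R : realType}.
Local Notation C := R[i].
Implicit Types z w : C.

Lemma normc_ge0 z : 0 <= normc z.
Proof. by case: z => a b; rewrite /= sqrtr_ge0. Qed.

Lemma normc_eq0 z : (normc z == 0) = (z == 0).
Proof.
apply/eqP/eqP => [/ComplexField.Normc.eq0_normc//|->].
exact: ComplexField.Normc.normc0.
Qed.

Lemma normc_gt0 z : (0 < normc z) = (z != 0).
Proof. by rewrite lt_neqAle normc_ge0 andbT eq_sym normc_eq0. Qed.

Lemma normcM z w : normc (z * w) = normc z * normc w.
Proof. exact: ComplexField.Normc.normcM. Qed.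

Lemma normcV z : normc z^-1 = (normc z)^-1.
Proof. exact: ComplexField.Normc.normcV. Qed.

Lemma normc_opp z : normc (- z) = normc z.
Proof. exact: normcN. Qed.

Lemma normcB z w : normc (z - w) = normc (w - z).
Proof. by rewrite -normc_opp opprB. Qed.

Lemma ler_normcD z w : normc (z + w) <= normc z + normc w.
Proof. exact: le_normcD. Qed.

Lemma ler_normcB z w : normc (z - w) <= normc z + normc w.
Proof. by rewrite -(normc_opp w) ler_normcD. Qed.

Lemma normc_conj z : normc z^*%C = normc z.
Proof. by case: z => a b /=; rewrite sqrrN. Qed.

Lemma normc_sqr z : normc z ^+ 2 = Re z ^+ 2 + Im z ^+ 2.
Proof. by case: z => a b /=; rewrite sqr_sqrtr // addr_ge0 // sqr_ge0. Qed.

Lemma normc_real (a : R) : normc a%:C = `|a|.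
Proof. by rewrite /= expr0n /= addr0 sqrtr_sqr. Qed.

Lemma norm_Re_le z : `|Re z| <= normc z.
Proof.
rewrite -ler_sqr ?nnegrE ?normr_ge0 ?normc_ge0 //.
by rewrite normc_sqr real_normK ?num_real // lerDl sqr_ge0.
Qed.

Lemma norm_Im_le z : `|Im z| <= normc z.
Proof.
rewrite -ler_sqr ?nnegrE ?normr_ge0 ?normc_ge0 //.
by rewrite normc_sqr real_normK ?num_real // lerDr sqr_ge0.
Qed.

Lemma normc_le_ReIm z : normc z <= `|Re z| + `|Im z|.
Proof.
rewrite -ler_sqr ?nnegrE ?addr_ge0 ?normr_ge0 ?normc_ge0 //.
rewrite normc_sqr sqrrD !real_normK ?num_real //.
by rewrite addrAC lerDl mulrn_wge0 // mulr_ge0.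
Qed.

Lemma unit_diskE z : unit_disk z = (normc z < 1) :> Prop.
Proof. by rewrite /unit_disk /= ltcR. Qed.

Lemma cplx_eta z : Re z +i* Im z = z.
Proof. by case: z. Qed.

Lemma Re_mulc z w : Re (z * w) = Re z * Re w - Im z * Im w.
Proof. by case: z; case: w. Qed.
Lemma Im_mulc z w : Im (z * w) = Re z * Im w + Im z * Re w.
Proof. by case: z; case: w. Qed.
Lemma ReD z w : Re (z + w) = Re z + Re w.
Proof. by case: z; case: w. Qed.
Lemma ImD z w : Im (z + w) = Im z + Im w.
Proof. by case: z; case: w. Qed.
Lemma ReN z : Re (- z) = - Re z.
Proof. by case: z. Qed.
Lemma ImN z : Im (- z) = - Im z.
Proof. by case: z. Qed.
Lemma ReJ z : Re (z^*%C) = Re z.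
Proof. by case: z. Qed.
Lemma ImJ z : Im (z^*%C) = - Im z.
Proof. by case: z. Qed.
Lemma ReV z : Re (z^-1) = Re z / (Re z ^+ 2 + Im z ^+ 2).
Proof. by case: z. Qed.
Lemma ImV z : Im (z^-1) = - (Im z / (Re z ^+ 2 + Im z ^+ 2)).
Proof. by case: z. Qed.
Definition ReImE := (Re_mulc, Im_mulc, ReD, ImD, ReN, ImN, ReJ, ImJ, ReV, ImV).

Lemma conjcM z w : (z * w)^*%C = z^*%C * w^*%C.
Proof. exact: (rmorphM conjc). Qed.

Lemma normcM_le z w (c d : R) :
  normc z <= c -> normc w <= d -> normc (z * w) <= c * d.
Proof. by move=> zc wd; rewrite normcM ler_pM ?normc_ge0. Qed.

Lemma normc_one_minus_gt0 z : normc z < 1 -> 0 < normc (1 - z).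
Proof.
move=> z1; have := ler_normcD (1 - z) z.
by rewrite subrK ComplexField.Normc.normc1; lra.
Qed.

Lemma normc_mul_lt1 z w : normc z < 1 -> normc w < 1 -> normc (z * w) < 1.
Proof.
move=> z1 w1; rewrite normcM.
by apply: mulr_ilt1; rewrite ?normc_ge0.
Qed.

End complex_modulus.

#[local] Arguments ComplexField.Normc.normc : simpl never.

(** * Calculus of uniform first order expansions *)

Section differentiability.
Context {R : realType}.
Local Notation C := R[i].
Implicit Types (A B : set C) (f g : C -> C).

(* First order Taylor expansion with a uniform quadratic remainder.  It yields
   holomorphy, bounds and real partial derivatives at once, and it is stable
   under the operations below without any topology. *)
Definition taylor1 A f f' := exists2 M : R, 0 <= M &
  forall z w, A z -> A w ->
    [/\ normc (f z) <= M, normc (f' z) <= M,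
        normc (f w - f z) <= M * normc (w - z) &
        normc (f w - f z - f' z * (w - z)) <= M * normc (w - z) ^+ 2].

Lemma eq_taylor1 A f g f' g' : (forall z, A z -> f z = g z) ->
  (forall z, A z -> f' z = g' z) -> taylor1 A f f' -> taylor1 A g g'.
Proof.
move=> fg f'g' [M M0 MP]; exists M => // z w Az Aw.
by have := MP z w Az Aw; rewrite !(fg z, fg w) // f'g'.
Qed.

Lemma taylor1_cst A (c : C) : taylor1 A (cst c) (cst 0).
Proof.
exists (normc c) => [|z w _ _]; first exact: normc_ge0.
rewrite /cst /= subrr mul0r subr0 ComplexField.Normc.normc0.
by split; rewrite ?lexx ?normc_ge0 // mulr_ge0 ?normc_ge0 // exprn_ge0 ?normc_ge0.
Qed.

Lemma taylor1_id : taylor1 unit_disk (fun z => z) (cst 1).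
Proof.
exists 1 => // z w; rewrite unit_diskE => z1 _.
rewrite /cst /= !mul1r subrr ComplexField.Normc.normc0 ComplexField.Normc.normc1.
by split; rewrite ?lexx // ?exprn_ge0 ?normc_ge0 // ltW.
Qed.

Lemma taylor1D A f g f' g' : taylor1 A f f' -> taylor1 A g g' ->
  taylor1 A (fun z => f z + g z) (fun z => f' z + g' z).
Proof.
move=> [M M0 MP] [N N0 NP]; exists (M + N) => [|z w Az Aw].
  exact: addr_ge0.
have [m1 m2 m3 m4] := MP z w Az Aw; have [n1 n2 n3 n4] := NP z w Az Aw.
split.
- by apply: (le_trans (ler_normcD _ _)); lra.
- by apply: (le_trans (ler_normcD _ _)); lra.
- rewrite opprD addrACA mulrDl.
  by apply: (le_trans (ler_normcD _ _)); lra.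
- have -> : f w + g w - (f z + g z) - (f' z + g' z) * (w - z) =
    (f w - f z - f' z * (w - z)) + (g w - g z - g' z * (w - z)) by ring.
  by rewrite mulrDl; apply: (le_trans (ler_normcD _ _)); lra.
Qed.

(** The remainder splits into three terms of size [M * N] times the squared distance: the two
    remainders, and the product of the increment of [g] with the linear part of [f]. Hence the
    constant 3. *)
Lemma taylor1M A f g f' g' : taylor1 A f f' -> taylor1 A g g' ->
  taylor1 A (fun z => f z * g z) (fun z => f' z * g z + f z * g' z).
Proof.
move=> [M M0 MP] [N N0 NP]; exists (3 * (M * N)) => [|z w Az Aw].
  by rewrite !mulr_ge0.
have [m1 m2 m3 m4] := MP z w Az Aw; have [n1 n2 n3 n4] := NP z w Az Aw.
have [m5 m6 _ _] := MP w w Aw Aw; have [n5 n6 _ _] := NP w w Aw Aw.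
have MN0 : 0 <= M * N by rewrite mulr_ge0.
have d0 : 0 <= normc (w - z) by exact: normc_ge0.
split.
- by apply: le_trans (normcM_le m1 n1) _; lra.
- apply: (le_trans (ler_normcD _ _)).
  by have := normcM_le m2 n1; have := normcM_le m1 n2; lra.
- have -> : f w * g w - f z * g z = (f w - f z) * g w + f z * (g w - g z).
    by ring.
  apply: (le_trans (ler_normcD _ _)).
  have := normcM_le m3 n5; have := normcM_le m1 n3.
  have : 0 <= M * N * normc (w - z) by rewrite mulr_ge0.
  lra.
- have -> : f w * g w - f z * g z - (f' z * g z + f z * g' z) * (w - z) =
    (f w - f z - f' z * (w - z)) * g w + f' z * (w - z) * (g w - g z) +
    f z * (g w - g z - g' z * (w - z)) by ring.
  apply: (le_trans (ler_normcD _ _)).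
  apply: (le_trans (lerD (ler_normcD _ _) (lexx _))).
  have := normcM_le m4 n5; have := normcM_le m1 n4.
  have := normcM_le (normcM_le m2 (lexx (normc (w - z)))) n3.
  lra.
Qed.

Lemma taylor1_comp A B f g f' g' : (forall z, A z -> B (g z)) ->
  taylor1 B f f' -> taylor1 A g g' ->
  taylor1 A (f \o g) (fun z => f' (g z) * g' z).
Proof.
move=> AB [M M0 MP] [N N0 NP].
exists (M * (1 + N + N ^+ 2)) => [|z w Az Aw].
  by rewrite mulr_ge0 ?addr_ge0 // exprn_ge0.
have [m1 m2 m3 m4] := MP _ _ (AB _ Az) (AB _ Aw).
have [n1 n2 n3 n4] := NP z w Az Aw.
have d0 : 0 <= normc (w - z) by exact: normc_ge0.
have MN0 : 0 <= M * N by rewrite mulr_ge0.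
have MN2 : 0 <= M * N ^+ 2 by rewrite mulr_ge0 ?exprn_ge0.
split => /=.
- by apply: le_trans m1 _; lra.
- by apply: le_trans (normcM_le m2 n2) _; lra.
- apply: le_trans m3 _.
  have : M * normc (g w - g z) <= M * (N * normc (w - z)).
    by rewrite ler_wpM2l.
  have : 0 <= M * normc (w - z) by rewrite mulr_ge0.
  have : 0 <= M * N ^+ 2 * normc (w - z) by rewrite mulr_ge0.
  lra.
- have -> : f (g w) - f (g z) - f' (g z) * g' z * (w - z) =
    (f (g w) - f (g z) - f' (g z) * (g w - g z)) +
    f' (g z) * (g w - g z - g' z * (w - z)) by ring.
  apply: (le_trans (ler_normcD _ _)).
  have := normcM_le m2 n4.
  have : M * normc (g w - g z) ^+ 2 <= M * (N * normc (w - z)) ^+ 2.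
    by rewrite ler_wpM2l // lerXn2r ?nnegrE ?normc_ge0 // mulr_ge0.
  have : 0 <= M * normc (w - z) ^+ 2 by rewrite mulr_ge0 ?exprn_ge0.
  rewrite exprMn; lra.
Qed.

Lemma taylor1_inv (a : R) : 0 < a ->
  taylor1 [set z | a <= normc z] (fun z => z^-1) (fun z => - (z^-1 * z^-1)).
Proof.
move=> a0; have ia0 : 0 < a^-1 by rewrite invr_gt0.
exists (a^-1 + a^-1 ^+ 2 + a^-1 ^+ 3) => [|z w /= az aw].
  by rewrite !addr_ge0 ?exprn_ge0 // ltW.
have [z0 w0] : z != 0 /\ w != 0.
  by rewrite -!normc_gt0; split; apply: lt_le_trans a0 _.
have iz : normc z^-1 <= a^-1 by rewrite normcV lef_pV2 ?posrE ?normc_gt0.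
have iw : normc w^-1 <= a^-1 by rewrite normcV lef_pV2 ?posrE ?normc_gt0.
have d0 : 0 <= normc (w - z) by exact: normc_ge0.
have p2 : 0 <= a^-1 ^+ 2 by rewrite exprn_ge0 // ltW.
have p3 : 0 <= a^-1 ^+ 3 by rewrite exprn_ge0 // ltW.
split.
- by lra.
- by rewrite normc_opp; apply: le_trans (normcM_le iz iz) _; lra.
- have -> : w^-1 - z^-1 = - (w^-1 * z^-1 * (w - z)).
    by field; rewrite z0.
  rewrite normc_opp.
  apply: le_trans (normcM_le (normcM_le iw iz) (lexx _)) _.
  by rewrite ler_wpM2r //; lra.
- have -> : w^-1 - z^-1 - - (z^-1 * z^-1) * (w - z) =
    w^-1 * z^-1 * z^-1 * ((w - z) * (w - z)).
    by field; rewrite z0.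
  apply: le_trans (normcM_le (normcM_le (normcM_le iw iz) iz)
    (lexx _)) _.
  by rewrite normcM -[normc (w - z) * _]expr2 ler_wpM2r ?exprn_ge0 //; lra.
Qed.

(** Adding the expansion at z towards w to the one at w towards z cancels the values of [f] and
    leaves (f' w - f' z) (w - z), of quadratic size; one factor |w - z| is then divided out. *)
Lemma taylor1_deriv_lip A f f' : taylor1 A f f' ->
  exists2 M : R, 0 <= M & forall z w, A z -> A w ->
    normc (f' w - f' z) <= M * normc (w - z).
Proof.
move=> [M M0 MP]; exists (2 * M) => [|z w Az Aw]; first by rewrite mulr_ge0.
have [->|wz] := eqVneq w z.
  by rewrite !subrr ComplexField.Normc.normc0 mulr0.
have d0 : 0 < normc (w - z) by rewrite normc_gt0 subr_eq0.
rewrite -(ler_pM2r d0) -normcM.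
have [_ _ _ m] := MP z w Az Aw; have [_ _ _ n] := MP w z Aw Az.
have -> : (f' w - f' z) * (w - z) = (f w - f z - f' z * (w - z)) +
  (f z - f w - f' w * (z - w)) by ring.
apply: le_trans (ler_normcD _ _) _.
by move: n; rewrite (normcB z w); lra.
Qed.

End differentiability.

(** * Powers on the right half-plane *)

Section paths.
Context {R : realType}.
Local Notation C := R[i].
Implicit Types (g h : R -> C) (t : R) (d e : C).

(** Split into coordinates so that the chain rules and the mean value theorem of the real line
    apply. *)
Definition cderiv g t d :=
  is_derive t 1 (fun x => Re (g x)) (Re d) /\
  is_derive t 1 (fun x => Im (g x)) (Im d).

Lemma is_derive_mul (f g : R -> R) t a b : is_derive t 1 f a ->
  is_derive t 1 g b -> is_derive t 1 (fun x => f x * g x) (a * g t + f t * b).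
Proof.
move=> fa gb; apply: is_derive_eq (is_deriveM fa gb) _.
by rewrite /GRing.scale /= addrC (mulrC (g t)).
Qed.

Lemma is_derive_add (f g : R -> R) t a b : is_derive t 1 f a ->
  is_derive t 1 g b -> is_derive t 1 (fun x => f x + g x) (a + b).
Proof. by move=> fa gb; apply: is_derive_eq (is_deriveD fa gb) _. Qed.

Lemma is_derive_opp (f : R -> R) t a : is_derive t 1 f a ->
  is_derive t 1 (fun x => - f x) (- a).
Proof. by move=> fa; apply: is_derive_eq (is_deriveN fa) _. Qed.

Lemma is_derive_const (c : R) t : is_derive t 1 (fun _ : R => c) 0.
Proof. exact: is_derive_cst. Qed.

Lemma cderiv_eq g t d e : cderiv g t d -> d = e -> cderiv g t e.
Proof. by move=> + <-. Qed.

Lemma cderiv_cst c t : cderiv (fun=> c) t 0.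
Proof. by split; exact: is_derive_const. Qed.

Lemma cderivD g h t d e : cderiv g t d -> cderiv h t e ->
  cderiv (fun x => g x + h x) t (d + e).
Proof.
move=> [gr gi] [hr hi]; split; rewrite !ReImE.
- have -> : (fun x => Re (g x + h x)) = (fun x => Re (g x) + Re (h x)).
    by apply/funext => x; rewrite !ReImE.
  exact: is_derive_add.
- have -> : (fun x => Im (g x + h x)) = (fun x => Im (g x) + Im (h x)).
    by apply/funext => x; rewrite !ReImE.
  exact: is_derive_add.
Qed.

Lemma cderivM g h t d e : cderiv g t d -> cderiv h t e ->
  cderiv (fun x => g x * h x) t (d * h t + g t * e).
Proof.
move=> [gr gi] [hr hi]; split; rewrite !ReImE.
- have -> : (fun x => Re (g x * h x)) =
    (fun x => Re (g x) * Re (h x) + - (Im (g x) * Im (h x))).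
    by apply/funext => x; rewrite !ReImE.
  apply: is_derive_eq (is_derive_add (is_derive_mul gr hr)
    (is_derive_opp (is_derive_mul gi hi))) _; ring.
- have -> : (fun x => Im (g x * h x)) =
    (fun x => Re (g x) * Im (h x) + Im (g x) * Re (h x)).
    by apply/funext => x; rewrite !ReImE.
  apply: is_derive_eq (is_derive_add (is_derive_mul gr hi)
    (is_derive_mul gi hr)) _; ring.
Qed.

Lemma cderivJ g t d : cderiv g t d -> cderiv (fun x => (g x)^*%C) t d^*%C.
Proof.
move=> [gr gi]; split; rewrite !ReImE.
- have -> : (fun x => Re (g x)^*%C) = (fun x => Re (g x)).
    by apply/funext => x; rewrite !ReImE.
  by [].
- have -> : (fun x => Im (g x)^*%C) = (fun x => - Im (g x)).
    by apply/funext => x; rewrite !ReImE.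
  exact: is_derive_opp.
Qed.

Lemma cderiv_real (f : R -> R) t a : is_derive t 1 f a ->
  cderiv (fun x => (f x)%:C) t a%:C.
Proof. by move=> fa; split => //=; exact: is_derive_const. Qed.

Lemma cderiv_line (z v : C) t : cderiv (fun x => z + x%:C * v) t v.
Proof.
apply: cderiv_eq (cderivD (cderiv_cst z t)
  (cderivM (cderiv_real (is_derive_id t 1)) (cderiv_cst v t))) _.
by rewrite mulr0 addr0 add0r mul1r.
Qed.

Lemma real_path_bound (f df : R -> R) (e B : R) :
  (forall t, 0 <= t <= 1 -> is_derive t 1 f (df t)) ->
  (forall t, 0 <= t <= 1 -> `|df t - e| <= B) -> `|f 1 - f 0 - e| <= B.
Proof.
move=> fdf dfB.
have fcont : {within `[0, 1], continuous f}.
  apply: derivable_within_continuous => x; rewrite in_itv /= => x01.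
  by have [] := fdf _ x01.
have fdf' (x : R) : x \in `]0, 1[ -> is_derive x 1 f (df x).
  by rewrite in_itv /= => /andP[x0 x1]; apply: fdf; rewrite !ltW.
have [c] := MVT (@ltr01 R) fdf' fcont.
rewrite in_itv /= => /andP[c0 c1] ->.
by rewrite subr0 mulr1; apply: dfB; rewrite !ltW.
Qed.

(** The mean value theorem fails for complex values; it is applied to each coordinate separately,
    which costs the factor 2. *)
Lemma path_bound g (dg : R -> C) e (B : R) :
  (forall t, 0 <= t <= 1 -> cderiv g t (dg t)) ->
  (forall t, 0 <= t <= 1 -> normc (dg t - e) <= B) ->
  normc (g 1 - g 0 - e) <= 2 * B.
Proof.
move=> gdg dgB; apply: le_trans (normc_le_ReIm _) _.
rewrite !ReImE mulrDl mul1r; apply: lerD.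
- apply: (@real_path_bound (fun t => Re (g t)) (fun t => Re (dg t))) => t t01.
  + by have [] := gdg t t01.
  + by apply: le_trans (dgB t t01); rewrite -ReN -ReD norm_Re_le.
- apply: (@real_path_bound (fun t => Im (g t)) (fun t => Im (dg t))) => t t01.
  + by have [] := gdg t t01.
  + by apply: le_trans (dgB t t01); rewrite -ImN -ImD norm_Im_le.
Qed.

End paths.

Section power.
Context {R : realType}.
Local Notation C := R[i].
Implicit Types (s : R) (z v : C).

(* [z ^ (- s)] on the right half-plane, in terms of functions whose
   derivatives are in the library; [cpow] uses [acos] and the modulus. *)
Definition npow s z : C :=
  let e := expR (- (s / 2) * ln (Re z ^+ 2 + Im z ^+ 2)) in
  let th := s * atan (Im z / Re z) in
  (e * cos th) +i* (- (e * sin th)).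

(** For Re z > 0 the angle [atan (Im z / Re z)] lies in ]-pi/2, pi/2[, has cosine Re z / |z| and the
    sign of Im z. So [acos] recovers it when Im z is nonnegative, and its opposite otherwise. *)
Lemma cArg_atan z : 0 < Re z -> cArg z = atan (Im z / Re z).
Proof.
move=> x0.
have n0 : 0 < normc z.
  by rewrite normc_gt0; apply: contraTneq x0 => ->; rewrite ltxx.
have cosE : Re z / normc z = cos (atan (Im z / Re z)).
  rewrite cos_atan.
  have -> : 1 + (Im z / Re z) ^+ 2 = (normc z / Re z) ^+ 2.
    by rewrite !expr_div_n normc_sqr; field; exact: lt0r_neq0.
  by rewrite sqrtr_sqr ger0_norm ?divr_ge0 ?ltW // invf_div.
have a1 := atan_ltpi2 (Im z / Re z).
have a2 := atan_gtNpi2 (Im z / Re z).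
have p0 := pi_gt0 R.
rewrite /cArg cosE; case: ifP => [y0|/negbT].
  rewrite cosK // in_itv /=; apply/andP; split; last by lra.
  by rewrite -(atan0 R); apply: le_atan; rewrite divr_ge0 // ltW.
rewrite -ltNge => y0; rewrite cosKN ?opprK //.
apply/andP; split; first by lra.
rewrite -[leRHS](atan0 R); apply: le_atan.
by rewrite ler_pdivrMr // mul0r ltW.
Qed.

Lemma npowE s z : 0 < Re z -> npow s z = (cpow z s)^-1.
Proof.
move=> x0.
have n0 : 0 < normc z.
  by rewrite normc_gt0; apply: contraTneq x0 => ->; rewrite ltxx.
rewrite /cpow cArg_atan // /npow -normc_sqr lnXn //.
rewrite /powR gt_eqF // -[ln _ *+ 2]mulr_natl.
have -> : - (s / 2) * (2 * ln (normc z)) = - (s * ln (normc z)) by field.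
rewrite expRN.
have e0 : expR (s * ln (normc z)) != 0 by rewrite gt_eqF // expR_gt0.
move: (expR _) e0 => e e0; set th := s * _.
apply/eqP; rewrite eq_complex !ReImE /= !exprMn -mulrDr cos2Dsin2 mulr1.
by apply/andP; split; apply/eqP; field.
Qed.

Lemma normc_npow s z :
  normc (npow s z) = expR (- (s / 2) * ln (Re z ^+ 2 + Im z ^+ 2)).
Proof.
rewrite /npow; set e := expR _; set th := s * _.
have e0 : 0 <= e by exact: expR_ge0.
rewrite /ComplexField.Normc.normc sqrrN !exprMn -mulrDr cos2Dsin2 mulr1.
by rewrite sqrtr_sqr ger0_norm.
Qed.

(** Along the line, the derivatives of ln|z| and of the argument are the real and the imaginary part
    of v / z. The product rule for modulus and angle reassembles them into -s z^(-s) v / z. *)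
Lemma cderiv_npow s z v t : 0 < Re (z + t%:C * v) ->
  cderiv (fun x => npow s (z + x%:C * v)) t
    (- s%:C * (npow s (z + t%:C * v) * (z + t%:C * v)^-1) * v).
Proof.
move=> x0; pose X x := Re (z + x%:C * v); pose Y x := Im (z + x%:C * v).
have [hX hY] : cderiv (fun x => z + x%:C * v) t v by exact: cderiv_line.
have Xt : 0 < X t by [].
have Nt : 0 < X t * X t + Y t * Y t by rewrite -!expr2 ltr_pwDl ?exprn_gt0 ?sqr_ge0.
have hN : is_derive t 1 (fun x => X x * X x + Y x * Y x)
    (2 * (X t * Re v + Y t * Im v)).
  apply: is_derive_eq (is_derive_add (is_derive_mul hX hX)
    (is_derive_mul hY hY)) _; rewrite /X /Y; ring.
have he : is_derive t 1
    (fun x => expR (- (s / 2) * ln (X x * X x + Y x * Y x)))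
    (expR (- (s / 2) * ln (X t * X t + Y t * Y t)) *
     (- s * ((X t * Re v + Y t * Im v) / (X t * X t + Y t * Y t)))).
  have hl := @is_derive1_comp _ (@ln R) (fun x => X x * X x + Y x * Y x)
    _ _ _ (is_derive1_ln Nt) hN.
  have hm := is_derive_mul (is_derive_const (- (s / 2)) t) hl.
  have hx := @is_derive1_comp _ (@expR R) _ _ _ _ (is_derive_expR _) hm.
  apply: is_derive_eq hx _.
  congr (_ * _); rewrite mul0r add0r.
  by move: (X t) (Y t) Nt => p q n0; field; exact: lt0r_neq0.
have hth : is_derive t 1 (fun x => s * atan (Y x / X x))
    (s * ((X t * Im v - Y t * Re v) / (X t * X t + Y t * Y t))).
  have hq := is_derive_mul hY (is_deriveV (lt0r_neq0 Xt) hX).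
  have ha := @is_derive1_comp _ (@atan R) (fun x => Y x / X x)
    _ _ _ (is_derive1_atan (Y t / X t)) hq.
  apply: is_derive_eq (is_derive_mul (is_derive_const s t) ha) _.
  rewrite mul0r add0r /GRing.scale /= -/(X t) -/(Y t); congr (_ * _).
  move: (X t) (Y t) Xt Nt => p q p0 n0; field.
  by rewrite -!expr2 in n0 *; rewrite !lt0r_neq0.
pose e x := expR (- (s / 2) * ln (X x * X x + Y x * Y x)).
pose th x := s * atan (Y x / X x).
have hc : is_derive t 1 (fun x => e x * cos (th x))
    (e t * (- s * ((X t * Re v + Y t * Im v) / (X t * X t + Y t * Y t))) *
     cos (th t) + e t * (- sin (th t) *
     (s * ((X t * Im v - Y t * Re v) / (X t * X t + Y t * Y t))))).
  exact: is_derive_mul he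
    (@is_derive1_comp _ (@cos R) _ _ _ _ (is_derive_cos _) hth).
have hs : is_derive t 1 (fun x => - (e x * sin (th x)))
    (- (e t * (- s * ((X t * Re v + Y t * Im v) / (X t * X t + Y t * Y t))) *
     sin (th t) + e t * (cos (th t) *
     (s * ((X t * Im v - Y t * Re v) / (X t * X t + Y t * Y t)))))).
  exact: is_derive_opp (is_derive_mul he
    (@is_derive1_comp _ (@sin R) _ _ _ _ (is_derive_sin _) hth)).
have npowE' x : npow s (z + x%:C * v) = (e x * cos (th x)) +i* (- (e x * sin (th x))).
  by rewrite /npow !expr2.
have zE : z + t%:C * v = X t +i* Y t by rewrite cplx_eta.
rewrite npowE' zE /cderiv; under eq_fun do rewrite npowE'.
under [X in _ /\ is_derive _ _ X _]eq_fun do rewrite npowE'.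
split; [apply: is_derive_eq hc _|apply: is_derive_eq hs _].
- move: (e t) (cos _) (sin _) (X t) (Y t) Nt => e' c d p q n0.
  by rewrite !ReImE /= !expr2; field; exact: lt0r_neq0.
- move: (e t) (cos _) (sin _) (X t) (Y t) Nt => e' c d p q n0.
  by rewrite !ReImE /= !expr2; field; exact: lt0r_neq0.
Qed.

(** With [rho] = |xi| it contains all values 1 - conj(xi) z for z in the unit disk. For [rho] < 1 it
    is convex, bounded, away from 0 and inside the right half-plane. *)
Definition disk1 (rho : R) : set C := [set z | normc (z - 1) <= rho].

Lemma disk1_Re rho z : disk1 rho z -> 1 - rho <= Re z.
Proof.
move=> zr; have := norm_Re_le (z - 1).
rewrite !ReImE /= ler_norml => /andP[h _].
by have := le_trans (lexx _) zr; lra.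
Qed.

Lemma disk1_norm rho z : disk1 rho z -> 1 - rho <= normc z <= 1 + rho.
Proof.
move=> zr; apply/andP; split.
  apply: le_trans (disk1_Re zr) _; apply: le_trans (norm_Re_le z).
  exact: ler_norm.
have := ler_normcD (z - 1) 1; rewrite subrK ComplexField.Normc.normc1.
by move: zr; rewrite /disk1 /=; lra.
Qed.

Lemma disk1_path rho z w t : 0 <= t <= 1 -> disk1 rho z -> disk1 rho w ->
  disk1 rho (z + t%:C * (w - z)).
Proof.
move=> /andP[t0 t1]; rewrite /disk1 /= => zr wr.
have -> : z + t%:C * (w - z) - 1 = (1 - t%:C) * (z - 1) + t%:C * (w - 1).
  by ring.
apply: le_trans (ler_normcD _ _) _; rewrite !normcM.
have -> : normc (1 - t%:C : C) = 1 - t.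
  by rewrite -(rmorphB (real_complex R)) normc_real ger0_norm // subr_ge0.
rewrite normc_real ger0_norm //.
have := ler_wpM2l t0 wr.
have t1' : 0 <= 1 - t by lra.
have := ler_wpM2l t1' zr; lra.
Qed.

Lemma npow_bounded s rho : 0 <= rho < 1 ->
  exists2 M, 0 <= M & forall z, disk1 rho z -> normc (npow s z) <= M.
Proof.
move=> /andP[rho0 rho1].
pose K := `|ln ((1 - rho) ^+ 2)| + `|ln ((1 + rho) ^+ 2)|.
exists (expR (`|s / 2| * K)) => [|z zr]; first exact: expR_ge0.
rewrite normc_npow ler_expR; apply: le_trans (ler_norm _) _.
rewrite normrM normrN ler_wpM2l //.
have /andP[n1 n2] := disk1_norm zr.
have r0 : 0 < 1 - rho by lra.
have r0' : 0 < 1 + rho by lra.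
have n0 : 0 < normc z by apply: lt_le_trans r0 _.
rewrite -normc_sqr.
have l1 : ln ((1 - rho) ^+ 2) <= ln (normc z ^+ 2).
  by rewrite ler_ln ?posrE ?exprn_gt0 // lerXn2r // nnegrE ltW.
have l2 : ln (normc z ^+ 2) <= ln ((1 + rho) ^+ 2).
  by rewrite ler_ln ?posrE ?exprn_gt0 // lerXn2r // nnegrE ltW.
rewrite /K; apply/ler_normlP; split.
- apply: le_trans (_ : `|ln ((1 - rho) ^+ 2)| <= _); last by rewrite lerDl.
  by rewrite -normrN; apply: le_trans (ler_norm _); rewrite lerN2.
- apply: le_trans (_ : `|ln ((1 + rho) ^+ 2)| <= _); last by rewrite lerDr.
  by apply: le_trans (ler_norm _).
Qed.

(** [path_bound] is used twice on the segment from z to w, which stays in the disk by convexity.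
    With [e] = 0 it gives a Lipschitz bound; with [e] the derivative at z it gives the quadratic
    remainder, since the derivative is Lipschitz in turn. *)
Lemma taylor1_npow s rho : 0 <= rho < 1 ->
  taylor1 (disk1 rho) (npow s) (fun z => - s%:C * (npow s z * z^-1)).
Proof.
move=> rho01; have [M M0 MP] := npow_bounded s rho01.
have rho1 : rho < 1 by case/andP: rho01.
have r0 : 0 < 1 - rho by lra.
have [I I0 IP] := taylor1_inv r0.
have inB z : disk1 rho z -> [set z | 1 - rho <= normc z] z.
  by move=> zr; have /andP[] := disk1_norm zr.
have Re0 z : disk1 rho z -> 0 < Re z.
  by move/disk1_Re; apply: lt_le_trans.
have Ib z : disk1 rho z -> normc (z^-1) <= I.
  by move=> zr; have [] := IP z z (inB _ zr) (inB _ zr).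
have S0 : 0 <= `|s| by [].
have db z : disk1 rho z -> normc (- s%:C * (npow s z * z^-1)) <= `|s| * (M * I).
  move=> zr; rewrite !normcM normc_opp normc_real ler_wpM2l //.
  by rewrite ler_pM ?normc_ge0 ?MP ?Ib.
pose L1 := 2 * (`|s| * (M * I)).
have L10 : 0 <= L1 by rewrite !mulr_ge0.
have cd z w t : disk1 rho z -> disk1 rho w -> 0 <= t <= 1 ->
    cderiv (fun x => npow s (z + x%:C * (w - z))) t
      (- s%:C * (npow s (z + t%:C * (w - z)) * (z + t%:C * (w - z))^-1) *
       (w - z)).
  by move=> zr wr t01; apply: cderiv_npow; apply: Re0; exact: disk1_path.
have lip z w : disk1 rho z -> disk1 rho w ->
    normc (npow s w - npow s z) <= L1 * normc (w - z).
  move=> zr wr.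
  have h : normc (npow s (z + 1%:C * (w - z)) - npow s (z + 0%:C * (w - z)) - 0)
      <= 2 * (`|s| * (M * I) * normc (w - z)).
    apply: (path_bound (fun t => @cd z w t zr wr)) => t t01.
    rewrite subr0 normcM ler_wpM2r ?normc_ge0 //; apply: db.
    exact: disk1_path.
  by move: h; rewrite mul1r (addrC z) subrK mul0r addr0 subr0 mulrA.
pose L2 := L1 * I + M * I.
have L20 : 0 <= L2 by rewrite addr_ge0 ?mulr_ge0.
have dlip z w : disk1 rho z -> disk1 rho w ->
    normc (npow s w * w^-1 - npow s z * z^-1) <= L2 * normc (w - z).
  move=> zr wr.
  have -> : npow s w * w^-1 - npow s z * z^-1 =
    (npow s w - npow s z) * w^-1 + npow s z * (w^-1 - z^-1) by ring.
  apply: le_trans (ler_normcD _ _) _; rewrite !normcM mulrDl.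
  apply: lerD.
    rewrite mulrAC; apply: ler_pM; rewrite ?normc_ge0 ?lip //.
    exact: Ib.
  rewrite -mulrA; apply: ler_pM; rewrite ?normc_ge0 ?MP //.
  by have [] := IP z w (inB _ zr) (inB _ wr).
exists (M + `|s| * (M * I) + L1 + 2 * (`|s| * L2)) => [|z w zr wr].
  by rewrite !addr_ge0 ?mulr_ge0.
have d0 : 0 <= normc (w - z) by exact: normc_ge0.
have p1 : 0 <= `|s| * (M * I) by rewrite !mulr_ge0.
have p2 : 0 <= `|s| * L2 by rewrite !mulr_ge0.
split.
- by apply: le_trans (MP _ zr) _; lra.
- by apply: le_trans (db _ zr) _; lra.
- by apply: le_trans (lip _ _ zr wr) _; rewrite ler_wpM2r //; lra.
- have h : normc (npow s (z + 1%:C * (w - z)) - npow s (z + 0%:C * (w - z)) -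
      - s%:C * (npow s z * z^-1) * (w - z))
      <= 2 * (`|s| * L2 * normc (w - z) ^+ 2).
    apply: (path_bound (fun t => @cd z w t zr wr)) => t t01.
    set zt := z + _.
    have ztr : disk1 rho zt by exact: disk1_path.
    rewrite -mulrBl -mulrBr !normcM normc_opp normc_real.
    rewrite expr2 !mulrA ler_wpM2r // -mulrA ler_wpM2l //.
    apply: le_trans (dlip _ _ zr ztr) _; rewrite ler_wpM2l //.
    have /andP[t0 t1] := t01.
    rewrite /zt addrAC subrr add0r normcM normc_real ger0_norm //.
    by rewrite ler_piMl.
  move: h; rewrite mul1r [X in npow s X - npow s _](addrC z) subrK mul0r addr0.
  move=> h; apply: le_trans h _.
  by rewrite mulrA ler_wpM2r ?exprn_ge0 //; lra.
Qed.

End power.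

(** * Continuity, measurability and partial derivatives on the disk *)

Section plane.
Context {R : realType}.
Local Notation C := R[i].
Local Notation leb2 := (@lebesgue2 R).
Implicit Types (p q : R * R) (u v : R * R -> R) (z : C) (g l : C -> C).

Lemma Re_cpt p : Re (cpt p) = p.1. Proof. by []. Qed.
Lemma Im_cpt p : Im (cpt p) = p.2. Proof. by []. Qed.

Lemma planar_diskE p : planar_disk p = (p.1 ^+ 2 + p.2 ^+ 2 < 1) :> Prop.
Proof.
rewrite /planar_disk /= unit_diskE.
have -> : p.1 ^+ 2 + p.2 ^+ 2 = normc (cpt p) ^+ 2 by rewrite normc_sqr.
rewrite -[X in _ ^+ 2 < X](expr1n R 2).
by rewrite ltr_pXn2r // ?nnegrE ?normc_ge0.
Qed.

Lemma continuous_sqr_sum : continuous (fun p : R * R => p.1 ^+ 2 + p.2 ^+ 2).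
Proof.
move=> p; apply: cvgD.
- apply: (@continuous_comp _ _ _ fst (fun x : R => x ^+ 2)).
    exact: cvg_fst.
  exact: exprn_continuous.
- apply: (@continuous_comp _ _ _ snd (fun x : R => x ^+ 2)).
    exact: cvg_snd.
  exact: exprn_continuous.
Qed.

Lemma open_planar_disk : open (@planar_disk R).
Proof.
have -> : @planar_disk R =
    (fun p : R * R => p.1 ^+ 2 + p.2 ^+ 2) @^-1` [set x | x < 1].
  by apply/funext => p; rewrite planar_diskE.
apply: open_comp; last exact: open_lt.
by move=> p _; exact: continuous_sqr_sum.
Qed.

(** Measurability refers to the product sigma-algebra. An open set is the union of the rational
    boxes it contains, and there are countably many of them; in [F], a box not contained in [U] is
    replaced by the empty set. *)
Lemma open_measurable2 (U : set (R * R)) : open U ->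
  measurable (U : set (measurableTypeR R * measurableTypeR R)).
Proof.
move=> oU.
pose box (q : (rat * rat) * (rat * rat)) : set (R * R) :=
  `]ratr q.1.1, ratr q.1.2[%classic `*` `]ratr q.2.1, ratr q.2.2[%classic.
pose F (b : (rat * rat) * (rat * rat)) :=
  if pselect (box b `<=` U) is left _ then box b else set0.
have -> : U = \bigcup_b F b.
  apply/seteqP; split => [p Up|p [b _]]; last first.
    by rewrite /F; case: pselect => // bU /bU.
  have [/= [A B] [/= pA pB] ABU] : nbhs p U by exact: open_nbhs_nbhs.
  have [a /= a0 aA] := pA; have [b /= b0 bB] := pB.
  have [q1 /[!in_itv]/= /andP[q1a q1b]] := @rat_in_itvoo R (p.1 - a) p.1 (ltac:(lra)).
  have [q2 /[!in_itv]/= /andP[q2a q2b]] := @rat_in_itvoo R p.1 (p.1 + a) (ltac:(lra)).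
  have [q3 /[!in_itv]/= /andP[q3a q3b]] := @rat_in_itvoo R (p.2 - b) p.2 (ltac:(lra)).
  have [q4 /[!in_itv]/= /andP[q4a q4b]] := @rat_in_itvoo R p.2 (p.2 + b) (ltac:(lra)).
  exists ((q1, q2), (q3, q4)) => //; rewrite /F; case: pselect => [_|[]].
    by split; rewrite /= in_itv /=; apply/andP.
  move=> [x y] [/= /[!in_itv]/= /andP[x1 x2] /andP[y1 y2]]; apply: ABU.
  split => /=.
    by apply: aA; rewrite /= ltr_distlC; lra.
  by apply: bB; rewrite /= ltr_distlC; lra.
apply: countable_bigcupT_measurable => [|b]; first exact: countableP.
rewrite /F; case: pselect => // _.
by apply: measurableX; exact: measurable_itv.
Qed.

Lemma measurable_planar_disk :
  measurable (@planar_disk R : set (measurableTypeR R * measurableTypeR R)).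
Proof. by apply: open_measurable2; exact: open_planar_disk. Qed.

Lemma continuous_measurable2 (D : set (R * R)) u : open D ->
  (forall p, D p -> {for p, continuous u}) ->
  measurable_fun (D : set (measurableTypeR R * measurableTypeR R))
    (u : _ -> measurableTypeR R).
Proof.
move=> oD cu.
apply: (measurability _ (measurable_realfun.RGenOpens.measurableE R)).
move=> _ [_ [a [b ->] <-]]; apply: open_measurable2.
rewrite openE => p [Dp up]; apply: filterI.
  exact: open_nbhs_nbhs.
apply: cu => //; exact: open_nbhs_nbhs.
Qed.

Definition disk_continuous u := forall p, planar_disk p -> {for p, continuous u}.

Lemma disk_continuousD u v : disk_continuous u -> disk_continuous v ->
  disk_continuous (fun p => u p + v p).
Proof. by move=> cu cv p Dp; apply: cvgD; [exact: cu|exact: cv]. Qed.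

Lemma disk_continuousM u v : disk_continuous u -> disk_continuous v ->
  disk_continuous (fun p => u p * v p).
Proof. by move=> cu cv p Dp; apply: cvgM; [exact: cu|exact: cv]. Qed.

Lemma disk_continuousN u : disk_continuous u ->
  disk_continuous (fun p => - u p).
Proof. by move=> cu p Dp; apply: cvgN; exact: cu. Qed.

Lemma disk_continuous_cst (c : R) : disk_continuous (fun=> c).
Proof. by move=> p _; exact: cvg_cst. Qed.

Lemma disk_continuous_lip (M : R) u :
  (forall p q, planar_disk p -> planar_disk q ->
    `|u p - u q| <= M * normc (cpt p - cpt q)) -> disk_continuous u.
Proof.
move=> uM p Dp; apply/cvgrPdist_le => e e0.
(* The sign of [M] is unknown, so 1 + |M| serves as a positive Lipschitz constant; the 2 accounts
   for the two coordinates. *)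
pose d := e / (2 * (1 + `|M|)).
have M0 : 0 < 1 + `|M| by rewrite ltr_pwDl.
have d0 : 0 < d by rewrite divr_gt0 // mulr_gt0.
have c1 : (fun q : R * R => q.1) @ p --> p.1 by exact: cvg_fst.
have c2 : (fun q : R * R => q.2) @ p --> p.2 by exact: cvg_snd.
have nD : nbhs p (@planar_disk R).
  by apply: open_nbhs_nbhs; split => //; exact: open_planar_disk.
near=> q.
have Dq : planar_disk q by near: q; exact: nD.
have q1 : `|p.1 - q.1| <= d.
  by near: q; move/cvgrPdist_le: c1; exact.
have q2 : `|p.2 - q.2| <= d.
  by near: q; move/cvgrPdist_le: c2; exact.
apply: le_trans (uM p q Dp Dq) _.
have n := normc_le_ReIm (cpt p - cpt q).
rewrite !ReImE !Re_cpt !Im_cpt in n.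
have n2 : normc (cpt p - cpt q) <= 2 * d by lra.
apply: le_trans (_ : (1 + `|M|) * normc (cpt p - cpt q) <= _).
  by rewrite ler_wpM2r ?normc_ge0 //; have := ler_norm M; lra.
apply: le_trans (_ : (1 + `|M|) * (2 * d) <= _); first by rewrite ler_pM2l.
by rewrite /d le_eqVlt; apply/orP; left; apply/eqP; field; exact: lt0r_neq0.
Unshelve. all: by end_near. Qed.

(** The bridge from quadratic remainders to derivatives in the topological sense. *)
Lemma is_derive_quadratic (f : R -> R) t (d M e : R) : 0 < e -> 0 <= M ->
  (forall k, `|k| < e -> `|f (t + k) - f t - d * k| <= M * k ^+ 2) ->
  is_derive t 1 f d.
Proof.
move=> e0 M0 H.
suff L : (fun h => h^-1 *: ((f \o shift t) (h *: (1 : R)) - f t)) @ 0^' --> d.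
  by apply: DeriveDef; [exact: cvgP L|exact: cvg_lim L].
apply/cvgrPdist_le => eps eps0.
near=> h.
have h0 : h != 0 by near: h; exact: nbhs_dnbhs_neq.
have he : `|h| < e by near: h; apply: dnbhs0_lt.
have hM : `|h| <= eps / (1 + M).
  by near: h; apply: dnbhs0_le; rewrite divr_gt0 // ltr_pwDl.
have hp : 0 < `|h| by rewrite normr_gt0.
have := H h he.
rewrite /shift /= /GRing.scale /= mulr1 (addrC t) => Hh.
rewrite -(ler_pM2l hp) -normrM.
have -> : h * (d - h^-1 * (f (h + t) - f t)) = - (f (h + t) - f t - d * h).
  by field.
rewrite normrN; apply: le_trans Hh _.
rewrite -real_normK ?num_real // expr2 mulrCA ler_pM2l // mulrC.
have M1 : 0 < 1 + M by rewrite ltr_pwDl.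
apply: le_trans (_ : `|h| * (1 + M) <= _).
  by rewrite ler_pM2l //; lra.
by rewrite -ler_pdivlMr.
Unshelve. all: by end_near. Qed.

Lemma cderiv_taylor1 (f f' : C -> C) (z v : C) (t : R) :
  taylor1 unit_disk f f' -> unit_disk (z + t%:C * v) ->
  cderiv (fun x => f (z + x%:C * v)) t (f' (z + t%:C * v) * v).
Proof.
move=> [M M0 MP]; set w := z + _ => Dw.
have w1 : normc w < 1 by rewrite -unit_diskE.
have v0 := normc_ge0 v.
have v1 : 0 < 1 + normc v by rewrite ltr_pwDl.
(* Steps shorter than [e] do not leave the disk; the 1 in the denominator covers v = 0. *)
pose e := (1 - normc w) / (1 + normc v).
have e0 : 0 < e by rewrite divr_gt0 // subr_gt0.
have H k : `|k| < e -> normc (f (z + (t + k)%:C * v) - f w - f' w * v * k%:C)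
    <= M * normc v ^+ 2 * k ^+ 2.
  move=> ke.
  have kE : z + (t + k)%:C * v - w = k%:C * v.
    by rewrite /w rmorphD /=; ring.
  have Dk : unit_disk (z + (t + k)%:C * v).
    rewrite unit_diskE.
    have -> : z + (t + k)%:C * v = w + k%:C * v by rewrite -kE; ring.
    apply: le_lt_trans (ler_normcD _ _) _.
    rewrite normcM normc_real.
    have : `|k| * (1 + normc v) < 1 - normc w by rewrite -ltr_pdivlMr.
    have : 0 <= `|k| by []; lra.
  have [_ _ _] := MP w (z + (t + k)%:C * v) Dw Dk.
  rewrite kE normcM normc_real exprMn real_normK ?num_real //.
  by rewrite -[f' w * v * _]mulrA [v * _]mulrC -[M * _ * _]mulrA
    [normc v ^+ 2 * _]mulrC.
have MN : 0 <= M * normc v ^+ 2 by rewrite mulr_ge0 ?exprn_ge0.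
split; apply: (is_derive_quadratic e0 MN) => k ke; apply: le_trans (H k ke).
- apply: le_trans (norm_Re_le _).
  by rewrite [X in _ <= `|X|]ReD ReD !ReN [Re (_ * k%:C)]Re_mulc /= mulr0 subr0.
- apply: le_trans (norm_Im_le _).
  by rewrite [X in _ <= `|X|]ImD ImD !ImN [Im (_ * k%:C)]Im_mulc /= mulr0 add0r.
Qed.

Lemma taylor1_derivable (f f' : C -> C) : taylor1 unit_disk f f' ->
  holomorphic_on unit_disk f.
Proof.
move=> [M M0 MP] z Dz.
have z1 : normc z < 1 by rewrite -unit_diskE.
apply/cvg_ex; exists (f' z).
have M1 : 0 < (1 + M)%:C by rewrite ltcR ltr_pwDl.
apply/cvgrPdist_le => eps eps0.
near=> h.
have h0 : h != 0 by near: h; exact: nbhs_dnbhs_neq.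
have he : `|h| < (1 - normc z)%:C.
  by near: h; apply: dnbhs0_lt; rewrite ltcR subr_gt0.
have hM : `|h| <= eps / (1 + M)%:C.
  by near: h; apply: dnbhs0_le; exact: divr_gt0.
have hp : 0 < `|h| by rewrite normr_gt0.
have Dh : unit_disk (h + z).
  rewrite unit_diskE; apply: le_lt_trans (ler_normcD _ _) _.
  by move: he; rewrite ltcR; lra.
have [_ _ _] := MP z (h + z) Dz Dh.
rewrite addrK => H.
rewrite /shift /= /GRing.scale /= mulr1.
rewrite -(ler_pM2l hp) -normrM.
have -> : h * (f' z - h^-1 * (f (h + z) - f z)) =
    - (f (h + z) - f z - f' z * h).
  by field.
rewrite normrN; apply: le_trans (_ : M%:C * `|h| ^+ 2 <= _).
  by rewrite -[`|h| ^+ 2](rmorphXn (real_complex R)) -rmorphM lecR.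
rewrite expr2 mulrCA ler_pM2l // mulrC.
apply: le_trans (_ : `|h| * (1 + M)%:C <= _).
  by rewrite ler_pM2l // lecR; lra.
by rewrite -ler_pdivlMr.
Unshelve. all: by end_near. Qed.

Lemma taylor1_Re_continuous (f f' : C -> C) : taylor1 unit_disk f f' ->
  disk_continuous (fun p => Re (f (cpt p))).
Proof.
move=> [M M0 MP]; apply: (@disk_continuous_lip M) => p q Dp Dq.
have [_ _ m _] := MP (cpt q) (cpt p) Dq Dp.
by apply: le_trans m; rewrite -ReN -ReD norm_Re_le.
Qed.

Lemma taylor1_Im_continuous (f f' : C -> C) : taylor1 unit_disk f f' ->
  disk_continuous (fun p => Im (f (cpt p))).
Proof.
move=> [M M0 MP]; apply: (@disk_continuous_lip M) => p q Dp Dq.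
have [_ _ m _] := MP (cpt q) (cpt p) Dq Dp.
by apply: le_trans m; rewrite -ImN -ImD norm_Im_le.
Qed.

Lemma taylor1_deriv_Re_continuous (f f' : C -> C) : taylor1 unit_disk f f' ->
  disk_continuous (fun p => Re (f' (cpt p))).
Proof.
move=> /taylor1_deriv_lip[M M0 MP].
apply: (@disk_continuous_lip M) => p q Dp Dq.
by apply: le_trans (MP _ _ Dq Dp); rewrite -ReN -ReD norm_Re_le.
Qed.

Lemma taylor1_deriv_Im_continuous (f f' : C -> C) : taylor1 unit_disk f f' ->
  disk_continuous (fun p => Im (f' (cpt p))).
Proof.
move=> /taylor1_deriv_lip[M M0 MP].
apply: (@disk_continuous_lip M) => p q Dp Dq.
by apply: le_trans (MP _ _ Dq Dp); rewrite -ImN -ImD norm_Im_le.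
Qed.

(** Polynomial in the coordinates: the square root inside [normc] would obstruct differentiation at
    0. *)
Definition rho (z : C) : R := 1 - (Re z ^+ 2 + Im z ^+ 2).

Lemma rhoE z : rho z = 1 - normc z ^+ 2.
Proof. by rewrite normc_sqr. Qed.

Lemma rho_gt0 z : unit_disk z -> 0 < rho z.
Proof.
rewrite unit_diskE rhoE subr_gt0 => z1.
by rewrite expr_lt1 ?normc_ge0.
Qed.

Lemma rho_le1 z : rho z <= 1.
Proof. by rewrite /rho gerBl addr_ge0 ?sqr_ge0. Qed.

Lemma disk_continuous_rho (a : R) :
  disk_continuous (fun p => rho (cpt p) `^ a).
Proof.
move=> p Dp; have r0 := rho_gt0 Dp.
apply: (@continuous_comp _ _ _ (fun p => rho (cpt p)) (fun x : R => x `^ a));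
  last first.
  have := is_derive1_powR a r0; case=> + _.
  by move=> /derivable1_diffP/differentiable_continuous.
apply: cvgB; first exact: cvg_cst.
exact: continuous_sqr_sum.
Qed.

Lemma powR_le_neg (a x y : R) : a <= 0 -> 0 < x -> x <= y -> y `^ a <= x `^ a.
Proof.
move=> a0 x0 xy; have y0 : 0 < y by apply: lt_le_trans xy.
rewrite -[a]opprK (powRN y) (powRN x) lef_pV2 ?posrE ?powR_gt0 //.
by apply: ge0_ler_powR; rewrite ?nnegrE ?oppr_ge0 // ltW.
Qed.

Lemma rho_pow_le1 (a : R) z : 0 <= a -> unit_disk z -> rho z `^ a <= 1.
Proof.
move=> a0 Dz; have r0 := rho_gt0 Dz.
have <- : 1 `^ a = 1 :> R by rewrite powR1.
apply: ge0_ler_powR; rewrite ?nnegrE ?rho_le1 //.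
exact: ltW.
Qed.

Definition cdisk_continuous (g : C -> C) :=
  disk_continuous (fun p => Re (g (cpt p))) /\
  disk_continuous (fun p => Im (g (cpt p))).

Lemma disk_continuous_eq u v : u =1 v -> disk_continuous u -> disk_continuous v.
Proof. by move=> /funext ->. Qed.

Lemma cdisk_continuousD g l : cdisk_continuous g -> cdisk_continuous l ->
  cdisk_continuous (fun z => g z + l z).
Proof.
move=> [gr gi] [lr li]; split.
- by apply: disk_continuous_eq (disk_continuousD gr lr) => p; rewrite ReD.
- by apply: disk_continuous_eq (disk_continuousD gi li) => p; rewrite ImD.
Qed.

Lemma cdisk_continuousM g l : cdisk_continuous g -> cdisk_continuous l ->
  cdisk_continuous (fun z => g z * l z).
Proof.
move=> [gr gi] [lr li]; split.
- apply: disk_continuous_eq (disk_continuousD (disk_continuousM gr lr)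
    (disk_continuousN (disk_continuousM gi li))) => p.
  by rewrite Re_mulc.
- apply: disk_continuous_eq (disk_continuousD (disk_continuousM gr li)
    (disk_continuousM gi lr)) => p.
  by rewrite Im_mulc.
Qed.

Lemma cdisk_continuousJ g : cdisk_continuous g ->
  cdisk_continuous (fun z => (g z)^*%C).
Proof.
move=> [gr gi]; split.
- by apply: disk_continuous_eq gr => p; rewrite ReJ.
- by apply: disk_continuous_eq (disk_continuousN gi) => p; rewrite ImJ.
Qed.

Lemma cdisk_continuous_real (u : C -> R) : disk_continuous (u \o cpt) ->
  cdisk_continuous (fun z => (u z)%:C).
Proof. by move=> cu; split => //; exact: disk_continuous_cst. Qed.

Lemma cdisk_continuous_cst (c : C) : cdisk_continuous (fun=> c).
Proof. by split; exact: disk_continuous_cst. Qed.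

Lemma taylor1_continuous (f f' : C -> C) : taylor1 unit_disk f f' ->
  cdisk_continuous f.
Proof.
by move=> ff'; split;
  [exact: taylor1_Re_continuous ff'|exact: taylor1_Im_continuous ff'].
Qed.

Lemma taylor1_deriv_continuous (f f' : C -> C) : taylor1 unit_disk f f' ->
  cdisk_continuous f'.
Proof.
by move=> ff'; split; [exact: taylor1_deriv_Re_continuous ff'|
  exact: taylor1_deriv_Im_continuous ff'].
Qed.

Lemma cdisk_continuous_id : cdisk_continuous (fun z => z).
Proof. exact: taylor1_continuous (@taylor1_id R). Qed.

End plane.

(** * Stokes' formula on subdisks *)

Section slices.
Context {R : realType}.
Local Notation C := R[i].
Local Notation leb2 := (@lebesgue2 R).
Local Notation mu := (@lebesgue_measure R).
Implicit Types (p q : R * R) (u v : R * R -> R).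

Definition subdisk (r : R) : set (R * R) :=
  [set p | p.1 ^+ 2 + p.2 ^+ 2 < r ^+ 2].

Lemma open_subdisk r : open (subdisk r).
Proof.
apply: (@open_comp _ _ (fun p : R * R => p.1 ^+ 2 + p.2 ^+ 2) [set x | x < r ^+ 2]);
  last exact: open_lt.
by move=> p _; exact: continuous_sqr_sum.
Qed.

Lemma measurable_subdisk r :
  measurable (subdisk r : set (measurableTypeR R * measurableTypeR R)).
Proof. by apply: open_measurable2; exact: open_subdisk. Qed.

Lemma interval_FTC (G g : R -> R) (b B : R) : 0 < b ->
  (forall x : R, - b <= x <= b -> is_derive x 1 G (g x)) ->
  (forall x : R, - b <= x <= b -> {for x, continuous g}) ->
  `|G b| <= B -> `|G (- b)| <= B ->
  (`|\int[mu]_(x in `](- b)%R, b[) (g x)%:E| <= (2 * B)%:E)%E.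
Proof.
move=> b0 Gg cg GB GNB.
have ab : - b < b by lra.
have cG (x : R) : - b <= x <= b -> {for x, continuous G}.
  move=> xb; apply: differentiable_continuous; apply/derivable1_diffP.
  by case: (Gg x xb).
have cgs : {within `[(- b), b], continuous g}.
  by apply: continuous_in_subspaceT => x; rewrite inE /= in_itv /=; exact: cg.
have mg : measurable_fun (`](- b)%R, b[%classic : set R) (EFin \o g).
  apply/measurable_EFinP; apply: open_continuous_measurable_fun.
    exact: interval_open.
  by move=> x; rewrite inE /= in_itv /= => /andP[x1 x2]; apply: cg; rewrite !ltW.
rewrite -(@integral_itv_bndoo _ _ _ _ true false) //.
rewrite (continuous_FTC2 ab cgs (F := G)).
- rewrite -EFinB lee_fin; apply: le_trans (ler_normB _ _) _; lra.
- split.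
  + by move=> x; rewrite in_itv /= => /andP[x1 x2]; case: (Gg x) => //; rewrite !ltW.
  + by apply: cvg_at_right_filter; apply: cG; rewrite lexx ltW.
  + by apply: cvg_at_left_filter; apply: cG; rewrite lexx ltW.
- move=> x; rewrite in_itv /= => /andP[x1 x2]; rewrite derive1E.
  by case: (Gg x) => //; rewrite !ltW.
Qed.

(** The chord of the subdisk at height [c] is ]-b, b[ with b^2 = r^2 - c^2. Its end points are on
    the circle, where [G] is at most [B]. Chords at height |c| >= r are empty, and the indicator
    makes the bound integrable in [c]. *)
Lemma slice_bound (G g : R -> R) (c r B : R) : 0 <= B -> r <= 1 -> 0 < r ->
  (forall x : R, x ^+ 2 + c ^+ 2 <= r ^+ 2 -> is_derive x 1 G (g x)) ->
  (forall x : R, x ^+ 2 + c ^+ 2 <= r ^+ 2 -> {for x, continuous g}) ->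
  (forall x : R, x ^+ 2 + c ^+ 2 = r ^+ 2 -> `|G x| <= B) ->
  (`|\int[mu]_x (if (x ^+ 2 + c ^+ 2 < r ^+ 2)%R then (g x)%:E else 0)|
    <= (2 * B)%:E * (\1_(`[(-1)%R, 1%R]%classic : set R) c)%:E)%E.
Proof.
move=> B0 r1 r0 Gg cg GB.
have [cr|rc] := ltrP (c ^+ 2) (r ^+ 2); last first.
  rewrite integral0_eq => [|x _].
    by rewrite abse0 -EFinM lee_fin mulr_ge0 // mulr_ge0.
  by rewrite ltNge (le_trans rc) // lerDr sqr_ge0.
pose b := Num.sqrt (r ^+ 2 - c ^+ 2).
have b0 : 0 < b by rewrite sqrtr_gt0 subr_gt0.
have b2 : b ^+ 2 = r ^+ 2 - c ^+ 2 by rewrite sqr_sqrtr // subr_ge0 ltW.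
have bP x : (x ^+ 2 + c ^+ 2 < r ^+ 2) = (- b < x < b).
  rewrite -ltr_norml -ltrBrDr -b2 -(real_normK (num_real x)).
  by rewrite ltr_pXn2r // nnegrE // ltW.
have bP' x : - b <= x <= b -> x ^+ 2 + c ^+ 2 <= r ^+ 2.
  rewrite -ler_norml -lerBrDr -b2 -(real_normK (num_real x)) => xb.
  by rewrite ler_pXn2r // nnegrE // ltW.
have -> : (\1_(`[(-1)%R, 1%R]%classic : set R) c) = 1 :> R.
  rewrite indicE mem_set // /= in_itv /= -ler_norml.
  rewrite -(@ler_pXn2r _ 2) ?nnegrE // real_normK ?num_real // expr1n.
  apply: le_trans (ltW cr) _; rewrite expr_le1 // ltW //.
rewrite mule1.
have -> : (\int[mu]_x (if (x ^+ 2 + c ^+ 2 < r ^+ 2)%R then (g x)%:E else 0))%E =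
    (\int[mu]_(x in `](- b)%R, b[) (g x)%:E)%E.
  rewrite [RHS]integral_mkcond; apply: eq_integral => x _.
  rewrite patchE bP; case: ifPn => [xb|xb].
    by rewrite mem_set //= in_itv.
  by rewrite memNset //= in_itv /=; apply/negP.
have bb : b ^+ 2 + c ^+ 2 = r ^+ 2 by rewrite b2 subrK.
apply: (@interval_FTC G) => // [x /bP'|x /bP'||].
- exact: Gg.
- exact: cg.
- exact: GB.
- by apply: GB; rewrite sqrrN.
Qed.

(** The interval [-1, 1] has length 2, hence 4 B. *)
Lemma integral_indic_bound (g : R -> \bar R) (B : R) : 0 <= B ->
  measurable_fun [set: R] g ->
  (forall y, `|g y| <= (2 * B)%:E * (\1_(`[(-1)%R, 1%R]%classic : set R) y)%:E)%E ->
  (`|\int[mu]_y g y| <= (4 * B)%:E)%E.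
Proof.
move=> B0 mg gB.
apply: le_trans (le_abse_integral mu measurableT mg) _.
have mI : measurable (`[(-1)%R, 1%R]%classic : set R) by exact: measurable_itv.
apply: le_trans (_ : \int[mu]_y ((2 * B)%:E *
    (\1_(`[(-1)%R, 1%R]%classic : set R) y)%:E) <= _)%E.
  apply: ge0_le_integral => //.
  - exact: measurableT_comp.
  - by apply/measurable_EFinP; apply: measurable_funM.
rewrite ge0_integralZl //.
- rewrite integral_indic // setIT; have := lebesgue_measure_itv `[(-1 : R), 1].
  rewrite /= lte_fin.
  have -> : (-1 : R) < 1 by lra.
  by move=> ->; rewrite -EFinB -EFinM lee_fin; lra.
- by apply/measurable_EFinP; exact: measurable_indic.
- by rewrite lee_fin mulr_ge0.
Qed.

Lemma slices1 (f : R * R -> \bar R) (B : R) : 0 <= B ->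
  leb2.-integrable [set: R * R] f ->
  (forall y, `|\int[mu]_x f (x, y)|
    <= (2 * B)%:E * (\1_(`[(-1)%R, 1%R]%classic : set R) y)%:E)%E ->
  (`|\int[leb2]_p f p| <= (4 * B)%:E)%E.
Proof.
move=> B0 fi fB; rewrite -(integral21_prod_meas1 fi).
exact: (integral_indic_bound B0 (measurable_fubini_G fi) fB).
Qed.

Lemma slices2 (f : R * R -> \bar R) (B : R) : 0 <= B ->
  leb2.-integrable [set: R * R] f ->
  (forall x, `|\int[mu]_y f (x, y)|
    <= (2 * B)%:E * (\1_(`[(-1)%R, 1%R]%classic : set R) x)%:E)%E ->
  (`|\int[leb2]_p f p| <= (4 * B)%:E)%E.
Proof.
move=> B0 fi fB; rewrite -(integral12_prod_meas1 fi).
exact: (integral_indic_bound B0 (measurable_fubini_F fi) fB).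
Qed.

End slices.

Section stokes.
Context {R : realType}.
Local Notation C := R[i].
Local Notation leb2 := (@lebesgue2 R).
Local Notation mu := (@lebesgue_measure R).
Implicit Types (p q : R * R) (u v : R * R -> R) (z : C).

Lemma subdisk_sub (r : R) : 0 < r -> r <= 1 ->
  subdisk r `<=` @planar_disk R.
Proof.
move=> r0 r1 p; rewrite /subdisk /= planar_diskE => /lt_le_trans; apply.
by rewrite expr_le1 // ltW.
Qed.

Lemma lebesgue2_disk_lt : (leb2 (@planar_disk R) < +oo)%E.
Proof.
have mI : measurable (`[(-1)%R, 1%R]%classic : set (measurableTypeR R)).
  exact: measurable_itv.
apply: (@le_lt_trans _ _ (leb2 (`[(-1)%R, 1%R] `*` `[(-1)%R, 1%R]))).
  apply: le_measure; rewrite ?inE.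
  - exact: measurable_planar_disk.
  - exact: measurableX.
  - move=> p; rewrite planar_diskE => p1.
    have h (x y : R) : x ^+ 2 + y ^+ 2 < 1 -> -1 <= x <= 1.
      move=> xy; rewrite -ler_norml -(@ler_pXn2r _ 2) ?nnegrE //.
      rewrite real_normK ?num_real // expr1n.
      by apply: le_trans (ltW xy); rewrite lerDl sqr_ge0.
    split; rewrite /= in_itv /=; first exact: h p1.
    by move: p1; rewrite addrC; exact: h.
have E : mu `[(-1)%R, 1%R]%classic = 2%:E.
  rewrite lebesgue_measure_itv /= lte_fin; have -> : (-1 : R) < 1 by lra.
  by rewrite -EFinB; congr _%:E; lra.
have -> : leb2 (`[(-1)%R, 1%R] `*` `[(-1)%R, 1%R]) = (2%:E * 2%:E)%E.
  by rewrite -E; exact: product_measure1E.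
by rewrite -EFinM ltry.
Qed.

Lemma disk_measurable u : disk_continuous u ->
  measurable_fun (@planar_disk R : set (measurableTypeR R * measurableTypeR R))
    (u : _ -> measurableTypeR R).
Proof. exact: continuous_measurable2 open_planar_disk. Qed.

Lemma disk_bounded_integrable u (A : set (R * R)) (K : R) :
  measurable (A : set (measurableTypeR R * measurableTypeR R)) ->
  A `<=` @planar_disk R -> disk_continuous u ->
  (forall p, A p -> `|u p| <= K) -> leb2.-integrable A (EFin \o u).
Proof.
move=> mA AD cu uK; apply: measurable_bounded_integrable => //.
- apply: le_lt_trans lebesgue2_disk_lt; apply: le_measure => //; rewrite inE //.
  exact: measurable_planar_disk.
- apply: measurable_funS (disk_measurable cu) => //.
  exact: measurable_planar_disk.
- exists K; split; first exact: num_real.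
  by move=> M KM p Ap; apply: le_trans (uK p Ap) (ltW KM).
Qed.

Lemma restrict_if (r : R) u :
  (EFin \o u) \_ (subdisk r) = (fun p =>
    if (p.1 ^+ 2 + p.2 ^+ 2 < r ^+ 2)%R then (u p)%:E else 0%E).
Proof.
apply/funext => p; rewrite patchE.
have [pr|pr] := boolP (p.1 ^+ 2 + p.2 ^+ 2 < r ^+ 2)%R.
  by rewrite mem_set.
by rewrite memNset //; apply/negP.
Qed.

Section one_direction.
Variables (r B K : R) (F dF : R * R -> R).
Hypotheses (r0 : 0 < r) (r1 : r < 1) (B0 : 0 <= B).
Hypothesis cdF : disk_continuous dF.
Hypothesis dFK : forall p, subdisk r p -> `|dF p| <= K.
Hypothesis FB : forall p, p.1 ^+ 2 + p.2 ^+ 2 = r ^+ 2 -> `|F p| <= B.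

Let fi : leb2.-integrable [set: R * R] ((EFin \o dF) \_ (subdisk r)).
Proof.
have mr := @measurable_subdisk R r.
apply/integrable_restrict => //; rewrite setTI.
apply: (@disk_bounded_integrable _ _ K) => //.
exact: subdisk_sub (ltW r1).
Qed.

Let inD (x y : R) : x ^+ 2 + y ^+ 2 <= r ^+ 2 -> planar_disk (x, y).
Proof.
move=> xy; rewrite planar_diskE /=; apply: le_lt_trans xy _.
by rewrite expr_lt1 // ltW.
Qed.

(** Stokes' formula in one coordinate. The bound [K] on the derivative serves integrability for
    Fubini and does not enter the estimate, so it may blow up as [r] tends to 1; the bound [B] on
    the circle is what counts. *)
Lemma integral_dx_bound :
  (forall p, planar_disk p -> is_derive p.1 1 (fun x => F (x, p.2)) (dF p)) ->
  (`|\int[leb2]_(p in subdisk r) (dF p)%:E| <= (4 * B)%:E)%E.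
Proof.
move=> FdF; rewrite integral_mkcond; apply: slices1 => // y.
rewrite restrict_if /=.
apply: (@slice_bound _ (fun x => F (x, y)) (fun x => dF (x, y))) => //.
- exact: ltW.
- by move=> x /inD Dxy; exact: FdF Dxy.
- move=> x /inD Dxy; apply: (@continuous_comp _ _ _ (fun x => (x, y)) dF).
    exact: (@cvg_pair _ _ _ (nbhs x) (nbhs x) (nbhs y) _ _ _ id (cst y)
      cvg_id (@cvg_cst _ _ _ _ _)).
  exact: cdF.
- by move=> x xy; exact: FB.
Qed.

Lemma integral_dy_bound :
  (forall p, planar_disk p -> is_derive p.2 1 (fun y => F (p.1, y)) (dF p)) ->
  (`|\int[leb2]_(p in subdisk r) (dF p)%:E| <= (4 * B)%:E)%E.
Proof.
move=> FdF; rewrite integral_mkcond; apply: slices2 => // x.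
rewrite restrict_if /=.
under eq_integral do rewrite addrC.
apply: (@slice_bound _ (fun y => F (x, y)) (fun y => dF (x, y))) => //.
- exact: ltW.
- by move=> y; rewrite addrC => /inD Dxy; exact: FdF Dxy.
- move=> y; rewrite addrC => /inD Dxy.
  apply: (@continuous_comp _ _ _ (fun y => (x, y)) dF).
    exact: (@cvg_pair _ _ _ (nbhs y) (nbhs x) (nbhs y) _ _ _ (cst x) id
      (@cvg_cst _ _ _ _ _) cvg_id).
  exact: cdF.
- by move=> y; rewrite addrC => xy; exact: FB.
Qed.

End one_direction.

End stokes.

Section complex_stokes.
Context {R : realType}.
Local Notation C := R[i].
Local Notation leb2 := (@lebesgue2 R).
Implicit Types (p q : R * R) (z v : C).
Variables (gamma : R) (h h' L L' : C -> C).
Hypotheses (gamma_gt : -1 < gamma) (gamma_le : gamma <= 0).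
Hypotheses (hh' : taylor1 unit_disk h h') (LL' : taylor1 unit_disk L L').

Let H z := h z * (L z)^*%C * (rho z `^ (gamma + 1))%:C.

(** The derivative of [H] in the real direction [v]; the last factor is the derivative of [rho] in
    that direction. *)
Let dH v z := (h' z * v * (L z)^*%C + h z * (L' z * v)^*%C) *
    (rho z `^ (gamma + 1))%:C +
  h z * (L z)^*%C *
    ((gamma + 1) * rho z `^ gamma * (- 2 * Re (z^*%C * v)))%:C.

(* Twice the Wirtinger derivative of [h * conj L * rho ^ (gamma + 1)] with
   respect to the conjugate variable. *)
Definition dbar z : C :=
  2%:C * (h z * (L' z)^*%C * (rho z `^ (gamma + 1))%:C) -
  2%:C * (z * h z * (L z)^*%C * ((gamma + 1) * rho z `^ gamma)%:C).

(** Twice the conjugate derivative is d/dx + i d/dy. The terms in h' cancel because i i = -1, those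
    in conj(L') double, and the derivatives of [rho] add up to -2 z. *)
Let dbarE z : dbar z = dH 1%:C z + 'i%C * dH 'i%C z.
Proof.
rewrite /dbar /dH; case: z => x y.
move: (h _) (h' _) (L _) (L' _) (rho _ `^ _) (rho _ `^ _).
move=> [a b] [a' b'] [c d] [c' d'] e e'.
by apply/eqP; rewrite eq_complex /=; apply/andP; split; apply/eqP; ring.
Qed.

Let rho_cderiv z v t : unit_disk (z + t%:C * v) ->
  is_derive t 1 (fun x => rho (z + x%:C * v) `^ (gamma + 1))
    ((gamma + 1) * rho (z + t%:C * v) `^ gamma *
     (- 2 * Re ((z + t%:C * v)^*%C * v))).
Proof.
move=> /rho_gt0 r0; have [hX hY] := cderiv_line z v t.
have hN := is_derive_add (is_derive_const 1 t)
  (is_derive_opp (is_derive_add (is_derive_mul hX hX) (is_derive_mul hY hY))).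
have hp := is_derive1_powR (gamma + 1) r0.
rewrite addrK in hp.
have := @is_derive1_comp _ (fun x : R => x `^ (gamma + 1))
  (fun x => 1 + - (Re (z + x%:C * v) * Re (z + x%:C * v) +
    Im (z + x%:C * v) * Im (z + x%:C * v))) t _ _.
rewrite -!expr2 => /(_ _ _ hp hN) hc.
have -> : (fun x => rho (z + x%:C * v) `^ (gamma + 1)) =
  (fun x : R => x `^ (gamma + 1)) \o
  (fun x => 1 + - (Re (z + x%:C * v) * Re (z + x%:C * v) +
    Im (z + x%:C * v) * Im (z + x%:C * v))).
  by apply/funext => x; rewrite /rho /= -!expr2.
apply: is_derive_eq hc _; congr (_ * _).
by rewrite !ReImE; ring.
Qed.

Let H_cderiv z v t : unit_disk (z + t%:C * v) ->
  cderiv (fun x => H (z + x%:C * v)) t (dH v (z + t%:C * v)).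
Proof.
move=> Dz.
have ch := cderiv_taylor1 hh' Dz.
have cL := cderivJ (cderiv_taylor1 LL' Dz).
exact: cderivM (cderivM ch cL) (cderiv_real (rho_cderiv Dz)).
Qed.

Let dH_continuous v : cdisk_continuous (dH v).
Proof.
have ch := taylor1_continuous hh'; have cL := taylor1_continuous LL'.
have ch' := taylor1_deriv_continuous hh'.
have cL' := taylor1_deriv_continuous LL'.
have cv := cdisk_continuous_cst v.
apply: cdisk_continuousD; apply: cdisk_continuousM.
- apply: cdisk_continuousD; apply: cdisk_continuousM => //.
  + exact: cdisk_continuousM.
  + exact: cdisk_continuousJ.
  + by apply: cdisk_continuousJ; exact: cdisk_continuousM.
- apply: cdisk_continuous_real; exact: disk_continuous_rho.
- by apply: cdisk_continuousM => //; exact: cdisk_continuousJ.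
- apply: cdisk_continuous_real; apply: disk_continuousM.
    apply: disk_continuousM; [exact: disk_continuous_cst|].
    exact: disk_continuous_rho.
  apply: disk_continuousM; first exact: disk_continuous_cst.
  have [] // := cdisk_continuousM (cdisk_continuousJ (@cdisk_continuous_id R)) cv.
Qed.

Lemma dbar_continuous : cdisk_continuous dbar.
Proof.
have -> : dbar = (fun z => dH 1%:C z + 'i%C * dH 'i%C z).
  by apply/funext => z; rewrite dbarE.
apply: cdisk_continuousD => //; apply: cdisk_continuousM => //.
exact: cdisk_continuous_cst.
Qed.

Let bounds : exists2 N : R, 0 <= N & forall z, unit_disk z ->
  [/\ normc (h z) <= N, normc (h' z) <= N, normc (L z) <= N &
      normc (L' z) <= N].
Proof.
have [M M0 MP] := hh'; have [K K0 KP] := LL'.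
exists (M + K) => [|z Dz]; first exact: addr_ge0.
have [m1 m2 _ _] := MP z z Dz Dz; have [k1 k2 _ _] := KP z z Dz Dz.
split; lra.
Qed.

(** As gamma <= 0, the power rho^gamma is largest where [rho] is smallest, that is, near the circle
    of radius [r]. *)
Let dH_bounded (r : R) v : normc v = 1 -> 0 < r < 1 -> exists K : R,
  forall p, subdisk r p -> normc (dH v (cpt p)) <= K.
Proof.
move=> v1 /andP[r0 r1]; have [N N0 NP] := bounds.
exists ((N * N + N * N) + N * N * ((gamma + 1) * (1 - r ^+ 2) `^ gamma * 2)).
move=> p pr; have Dp : unit_disk (cpt p) by apply: (subdisk_sub r0 (ltW r1)) pr.
have [h1 h2 L1 L2] := NP _ Dp; set z := cpt p in Dp h1 h2 L1 L2 *.
have g0 : 0 <= gamma + 1 by rewrite -lerBlDr sub0r ltW.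
have z1 : normc z <= 1 by rewrite ltW // -unit_diskE.
have r20 : 0 < 1 - r ^+ 2 by rewrite subr_gt0 expr_lt1 // ltW.
have rp : 1 - r ^+ 2 <= rho z by rewrite /rho lerD2l lerN2 ltW.
apply: le_trans (ler_normcD _ _) _; apply: lerD.
- rewrite -[leRHS]mulr1; apply: normcM_le.
    apply: le_trans (ler_normcD _ _) _; apply: lerD.
      apply: normcM_le; last by rewrite normc_conj.
      by rewrite normcM v1 mulr1.
    by apply: normcM_le => //; rewrite normc_conj normcM v1 mulr1.
  by rewrite normc_real ger0_norm ?powR_ge0 // rho_pow_le1.
- apply: normcM_le; first by apply: normcM_le => //; rewrite normc_conj.
  rewrite normc_real normrM ger0_norm ?mulr_ge0 ?powR_ge0 //.
  apply: ler_pM; rewrite ?mulr_ge0 ?powR_ge0 //.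
    by rewrite ler_wpM2l // powR_le_neg.
  rewrite normrM normrN normr_nat -[leRHS]mulr1 ler_wpM2l //.
  apply: le_trans (norm_Re_le _) _.
  by rewrite normcM normc_conj v1 mulr1.
Qed.

(** The real part of d/dx H + i d/dy H is d/dx (Re H) - d/dy (Im H), and each term is integrated
    along its own direction. On the circle, |H| is at most N^2 (1 - r^2)^(gamma + 1); two terms with
    the factor 4 give 8, and [M] does not depend on [r]. *)
Lemma dbar_subdisk_bound : exists2 M : R, 0 <= M & forall r : R, 0 < r < 1 ->
  (`|\int[leb2]_(p in subdisk r) (Re (dbar (cpt p)))%:E| <=
   (M * (1 - r ^+ 2) `^ (gamma + 1))%:E)%E.
Proof.
have [N N0 NP] := bounds.
exists (8 * (N * N)) => [|r rP]; first by rewrite !mulr_ge0.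
have [r0 r1] : 0 < r /\ r < 1 by case/andP: rP.
pose B := N * N * (1 - r ^+ 2) `^ (gamma + 1).
have B0 : 0 <= B by rewrite !mulr_ge0 ?powR_ge0.
have HB p : p.1 ^+ 2 + p.2 ^+ 2 = r ^+ 2 -> normc (H (cpt p)) <= B.
  move=> pr; have Dp : planar_disk p by rewrite planar_diskE pr expr_lt1 // ltW.
  have [h1 _ L1 _] := NP _ Dp.
  rewrite /H !normcM normc_conj normc_real ger0_norm ?powR_ge0 //.
  rewrite /rho Re_cpt Im_cpt pr ler_wpM2r ?powR_ge0 //.
  by rewrite ler_pM ?normc_ge0.
have [K1 K1P] := dH_bounded (@ComplexField.Normc.normc1 R) rP.
have i1 : normc ('i%C : C) = 1.
  by rewrite /ComplexField.Normc.normc expr0n add0r expr1n sqrtr1.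
have [K2 K2P] := dH_bounded i1 rP.
have [cRe1 _] := dH_continuous 1; have [_ cImi] := dH_continuous 'i%C.
have mr := @measurable_subdisk R r.
have sD := @subdisk_sub R r r0 (ltW r1).
have b1 : (`|\int[leb2]_(p in subdisk r) (Re (dH 1 (cpt p)))%:E| <= (4 * B)%:E)%E.
  apply: (@integral_dx_bound _ r B K1 (fun p => Re (H (cpt p)))) => //.
  - by move=> p pr; apply: le_trans (norm_Re_le _) (K1P p pr).
  - by move=> p pr; apply: le_trans (norm_Re_le _) (HB p pr).
  - move=> p Dp.
    have E x : cpt (x, p.2) = (0 +i* p.2) + x%:C * 1 :> C.
      by rewrite mulr1; apply/eqP; rewrite eq_complex /= add0r addr0 !eqxx.
    have Ep : cpt p = (0 +i* p.2) + p.1%:C * 1 :> C by rewrite -E -surjective_pairing.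
    have -> : (fun x => Re (H (cpt (x, p.2)))) =
      (fun x => Re (H ((0 +i* p.2) + x%:C * 1))).
      by apply/funext => x; rewrite E.
    by have [] := @H_cderiv (0 +i* p.2) 1 p.1; rewrite -?Ep.
have b2 : (`|\int[leb2]_(p in subdisk r) (Im (dH 'i%C (cpt p)))%:E| <= (4 * B)%:E)%E.
  apply: (@integral_dy_bound _ r B K2 (fun p => Im (H (cpt p)))) => //.
  - by move=> p pr; apply: le_trans (norm_Im_le _) (K2P p pr).
  - by move=> p pr; apply: le_trans (norm_Im_le _) (HB p pr).
  - move=> p Dp.
    have E y : cpt (p.1, y) = (p.1 +i* 0) + y%:C * 'i%C :> C.
      apply/eqP; rewrite eq_complex /= !mulr0 !mul0r !mulr1.
      by rewrite ?subr0 ?addr0 ?add0r !eqxx.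
    have Ep : cpt p = (p.1 +i* 0) + p.2%:C * 'i%C :> C by rewrite -E -surjective_pairing.
    have -> : (fun y => Im (H (cpt (p.1, y)))) =
      (fun y => Im (H ((p.1 +i* 0) + y%:C * 'i%C))).
      by apply/funext => y; rewrite E.
    by have [] := @H_cderiv (p.1 +i* 0) 'i%C p.2; rewrite -?Ep.
have -> : (\int[leb2]_(p in subdisk r) (Re (dbar (cpt p)))%:E =
   \int[leb2]_(p in subdisk r) (Re (dH 1 (cpt p)))%:E -
   \int[leb2]_(p in subdisk r) (Im (dH 'i%C (cpt p)))%:E)%E.
  rewrite -integralB_EFin //.
  - by apply: eq_integral => p _; rewrite dbarE !ReImE /= mul0r mul1r sub0r.
  - apply: (@disk_bounded_integrable _ _ _ K1) => // p pr.
    by apply: le_trans (norm_Re_le _) (K1P p pr).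
  - apply: (@disk_bounded_integrable _ _ _ K2) => // p pr.
    by apply: le_trans (norm_Im_le _) (K2P p pr).
apply: le_trans (lee_abs_sub _ _) _.
apply: le_trans (leeD b1 b2) _; rewrite -EFinD lee_fin /B; lra.
Qed.

End complex_stokes.

(** * Exhaustion of the disk by subdisks *)

Section exhaustion.
Context {R : realType}.
Local Notation C := R[i].
Local Notation leb2 := (@lebesgue2 R).
Local Notation plane := (measurableTypeR R * measurableTypeR R)%type.
Implicit Types (p q : R * R) (z : C).
Variable a : R.
Hypothesis a0 : 0 < a.

(** The factor one half keeps [shrink 0] below 1, hence [radius 0] positive. *)
Definition shrink (n : nat) : R := 2^-1 * n.+1%:R^-1.

Lemma shrink_gt0 n : 0 < shrink n.
Proof. by rewrite mulr_gt0 ?invr_gt0. Qed.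

Lemma shrink_lt1 n : shrink n < 1.
Proof.
apply: le_lt_trans (_ : 2^-1 < 1); last by rewrite invf_lt1 // ltr1n.
by rewrite ler_piMr // invf_le1 // ler1n.
Qed.

Lemma shrink_anti m n : (m <= n)%N -> shrink n <= shrink m.
Proof. by move=> mn; rewrite ler_pM2l // lef_pV2 ?posrE // ler_nat. Qed.

Lemma shrink_cvg (c : R) : (fun n => c * shrink n) @ \oo --> 0.
Proof.
have -> : (fun n => c * shrink n) = (fun n => c * 2^-1 * harmonic n).
  by apply/funext => n; rewrite /shrink /harmonic mulrA.
rewrite -[X in _ --> X](mulr0 (c * 2^-1)).
by apply: cvgM; [exact: cvg_cst|exact: cvg_harmonic].
Qed.

(* Chosen so that [(1 - radius n ^ 2) ^ a = shrink n]. *)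
Definition radius (n : nat) : R := Num.sqrt (1 - shrink n `^ a^-1).

Let pow_lt1 n : shrink n `^ a^-1 < 1.
Proof.
have <- : 1 `^ a^-1 = 1 :> R by rewrite powR1.
apply: gt0_ltr_powR; rewrite ?invr_gt0 ?nnegrE ?shrink_lt1 //.
exact: ltW (shrink_gt0 n).
Qed.

Lemma radius2 n : radius n ^+ 2 = 1 - shrink n `^ a^-1.
Proof. by rewrite sqr_sqrtr // subr_ge0 ltW. Qed.

Lemma radius01 n : 0 < radius n < 1.
Proof.
rewrite sqrtr_gt0 subr_gt0 pow_lt1 /= -(@ltr_pXn2r _ 2) ?nnegrE ?sqrtr_ge0 //.
by rewrite radius2 expr1n gtrBl powR_gt0 // shrink_gt0.
Qed.

Lemma radius_pow n : (1 - radius n ^+ 2) `^ a = shrink n.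
Proof.
rewrite radius2 subKr -powRrM mulVf ?gt_eqF // powRr1 //.
exact: ltW (shrink_gt0 n).
Qed.

Lemma subdisk_radius_mono : nondecreasing_seq (fun n => subdisk (radius n)).
Proof.
move=> m n mn; apply/subsetPset => p; rewrite /subdisk /= !radius2.
move=> /lt_le_trans; apply; rewrite lerD2l lerN2.
apply: ge0_ler_powR; rewrite ?invr_ge0 ?nnegrE ?shrink_anti // ltW //;
exact: shrink_gt0.
Qed.

Lemma subdisk_radius_eventually p : planar_disk p ->
  \forall n \near \oo, subdisk (radius n) p.
Proof.
move=> Dp; have r0 := rho_gt0 (Dp : unit_disk (cpt p)).
have ra0 : 0 < rho (cpt p) `^ a by rewrite powR_gt0.
have := near_infty_natSinv_lt (PosNum ra0); apply: filterS => n /= h.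
rewrite /subdisk /= radius2 ltrBrDr addrC -ltrBrDr -[X in _ < X]/(rho (cpt p)).
have <- : (rho (cpt p) `^ a) `^ a^-1 = rho (cpt p).
  by rewrite -powRrM mulfV ?gt_eqF // powRr1 // ltW.
apply: gt0_ltr_powR; rewrite ?invr_gt0 ?nnegrE ?powR_ge0 //.
  exact: ltW (shrink_gt0 n).
apply: le_lt_trans h; rewrite /shrink ler_piMl // invf_le1 //.
by rewrite ler1n.
Qed.

Lemma subdisk_radius_bigcup : \bigcup_n subdisk (radius n) = @planar_disk R.
Proof.
apply/seteqP; split => [p [n _]|p Dp].
  have /andP[n0 n1] := radius01 n.
  exact: subdisk_sub n0 (ltW n1) p.
have [n _ nP] := subdisk_radius_eventually Dp.
by exists n => //; apply: nP => /=.
Qed.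

(** The integrals over the subdisks converge to the integral over the disk by dominated convergence,
    and by the choice of [radius] they are at most [M * shrink n] in absolute value. *)
Lemma integral_disk_eq0 (u : R * R -> R) (g : R * R -> R) (M : R) :
  disk_continuous u -> leb2.-integrable (@planar_disk R) (EFin \o g) ->
  (forall p, planar_disk p -> `|u p| <= g p) ->
  (forall r : R, 0 < r < 1 ->
    (`|\int[leb2]_(p in subdisk r) (u p)%:E| <= (M * (1 - r ^+ 2) `^ a)%:E)%E) ->
  (\int[leb2]_(p in @planar_disk R) (u p)%:E = 0)%E.
Proof.
move=> cu ig ug ub; have mD := @measurable_planar_disk R.
pose f_ n : R * R -> \bar R := (EFin \o u) \_ (subdisk (radius n)).
have mu_ : measurable_fun (@planar_disk R : set plane) (EFin \o u).
  by apply/measurable_EFinP; exact: disk_measurable.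
have sub n : subdisk (radius n) `<=` @planar_disk R.
  by have /andP[n0 n1] := radius01 n; exact: subdisk_sub n0 (ltW n1).
have mf n : measurable_fun (@planar_disk R : set plane) (f_ n).
  apply/measurable_restrict => //; first exact: measurable_subdisk.
  by apply: measurable_funS mu_ => //; exact: subIsetl.
have [||_ _] := @dominated_convergence _ _ _ leb2 _ mD f_ (EFin \o u) (EFin \o g)
  mf mu_ _ ig _.
- apply: aeW => p Dp; apply: cvg_near_cst.
  apply: filterS (subdisk_radius_eventually Dp) => n np.
  by rewrite /f_ patchE mem_set.
- apply: aeW => p n Dp; rewrite /f_ patchE; case: ifP => _ /=.
    by rewrite lee_fin ug.
  by rewrite normr0 lee_fin; apply: le_trans (ug p Dp).
have E n : (\int[leb2]_(p in @planar_disk R) f_ n p =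
    \int[leb2]_(p in subdisk (radius n)) (u p)%:E)%E.
  by rewrite -integral_mkcondr setIidr.
under eq_fun do rewrite E.
move=> cI; apply: (cvg_unique (@ereal_hausdorff R) cI).
apply: (@squeeze_cvge _ _ _ _ (fun n => (- (M * shrink n))%:E) _
  (fun n => (M * shrink n)%:E)).
- apply: nearW => n; have := ub _ (radius01 n); rewrite radius_pow.
  move=> h; apply/andP; split; last exact: le_trans (lee_abs _) h.
  by rewrite EFinN leeNl; apply: le_trans h; rewrite -abseN lee_abs.
- apply: cvg_EFin; first exact: nearW.
  have := shrink_cvg (- M); under eq_fun do rewrite mulNr; exact.
- apply: cvg_EFin; first exact: nearW.
  exact: shrink_cvg.
Qed.

End exhaustion.

(** * Weighted integrals over the disk *)

Section weighted_integral.
Context {R : realType}.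
Local Notation C := R[i].
Local Notation leb2 := (@lebesgue2 R).
Local Notation plane := (measurableTypeR R * measurableTypeR R)%type.
Implicit Types (p q : R * R) (z : C).
Variable gamma : R.
Hypotheses (gamma_gt : -1 < gamma) (gamma_le : gamma <= 0).

Let a := gamma + 1.
Let a0 : 0 < a. Proof. by rewrite -ltrBlDr sub0r. Qed.

Let a_ge0 : 0 <= a. Proof. exact: ltW. Qed.
Let a1_ge0 : 0 <= a + 1. Proof. exact: addr_ge0. Qed.
Let ia_ge0 : 0 <= a^-1. Proof. by rewrite invr_ge0. Qed.

Let mD := @measurable_planar_disk R.

Lemma rho_powS z : unit_disk z -> rho z `^ a = rho z * rho z `^ gamma.
Proof.
move=> /rho_gt0 r0; rewrite powRD; last by rewrite (gt_eqF r0) implybT.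
by rewrite powRr1 ?ltW // mulrC.
Qed.

(** With h = 1 and L(z) = z, the conjugate derivative has real part 2 (a + 1) rho^a - 2 a rho^gamma,
    where a = gamma + 1. Its integral over subdisks is bounded and rho^a <= 1, so the integrals of
    rho^gamma are bounded too; monotone convergence concludes. *)
Lemma rho_pow_integrable :
  leb2.-integrable (@planar_disk R) (EFin \o (fun p => rho (cpt p) `^ gamma)).
Proof.
have t1 : taylor1 unit_disk (cst (1 : C)) (cst 0) by exact: taylor1_cst.
have [M M0 MP] := dbar_subdisk_bound gamma_gt gamma_le t1 (@taylor1_id R).
have [cRe _] := dbar_continuous gamma t1 (@taylor1_id R).
set db := dbar _ _ _ _ in MP cRe.
have dbE z : Re (db z) = 2 * rho z `^ a - 2 * a * (1 - rho z) * rho z `^ gamma.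
  rewrite /db /dbar /rho /cst; case: z => x y.
  move: (_ `^ _) (_ `^ _) => e e'; rewrite /= /a; ring.
have ptw p : planar_disk p ->
    rho (cpt p) `^ gamma <= a^-1 * ((a + 1) - 2^-1 * Re (db (cpt p))).
  move=> Dp; rewrite ler_pdivlMl // dbE.
  have := @rho_pow_le1 R a (cpt p) (ltW a0) Dp.
  rewrite (rho_powS Dp).
  move: (rho _) (_ `^ _) => s e se1.
  have : 0 <= (a + 1) * (1 - s * e) by rewrite mulr_ge0 ?subr_ge0.
  lra.
pose lD := fine (leb2 (@planar_disk R)).
have lDE : leb2 (@planar_disk R) = lD%:E.
  by rewrite fineK // ge0_fin_numE // lebesgue2_disk_lt.
(* The pointwise bound [ptw] integrated over a subdisk: its area is at most [lD], and its boundary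
   term at most [M * shrink n <= M]. *)
pose K := a^-1 * ((a + 1) * lD + 2^-1 * M).
have cr := @disk_continuous_rho R gamma.
have mr : measurable_fun (@planar_disk R : set plane)
    (EFin \o (fun p => rho (cpt p) `^ gamma)).
  by apply/measurable_EFinP; exact: disk_measurable.
have sub n : subdisk (radius a n) `<=` @planar_disk R.
  by have /andP[n0 n1] := radius01 a0 n; exact: subdisk_sub n0 (ltW n1).
have ms n := @measurable_subdisk R (radius a n).
have bnd n : (\int[leb2]_(p in subdisk (radius a n))
    (rho (cpt p) `^ gamma)%:E <= K%:E)%E.
  have /andP[n0 n1] := radius01 a0 n.
  have r20 : 0 < 1 - radius a n ^+ 2 by rewrite subr_gt0 expr_lt1 // ltW.
  have rp p : subdisk (radius a n) p -> 1 - radius a n ^+ 2 <= rho (cpt p).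
    by move=> pn; rewrite /rho lerD2l lerN2 ltW.
  have e2 : 0 <= (1 - radius a n ^+ 2) `^ gamma by exact: powR_ge0.
  (* The bound on [db] may grow with [n]; it only justifies splitting the integral. *)
  have dbi : leb2.-integrable (subdisk (radius a n))
      (EFin \o (fun p => Re (db (cpt p)))).
    apply: (@disk_bounded_integrable _ _ _
      (2 + 2 * a * (1 - radius a n ^+ 2) `^ gamma)) => // p pn.
    have Dp := sub n p pn.
    rewrite dbE; apply: le_trans (ler_normB _ _) _; apply: lerD.
      by rewrite ger0_norm ?mulr_ge0 ?powR_ge0 // ler_piMr // rho_pow_le1.
    have r0 := rho_gt0 (Dp : unit_disk (cpt p)).
    have r1 : 0 <= 1 - rho (cpt p) by rewrite subr_ge0 rho_le1.
    rewrite ger0_norm; last by rewrite !mulr_ge0 ?powR_ge0 // ltW.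
    apply: ler_pM; rewrite ?mulr_ge0 ?powR_ge0 //; try exact: ltW.
      by rewrite ler_piMr ?mulr_ge0 ?(ltW a0) // gerBl ltW.
    by apply: powR_le_neg => //; exact: rp.
  have ci : leb2.-integrable (subdisk (radius a n)) (EFin \o cst (a^-1 * (a + 1))).
    apply: (@disk_bounded_integrable _ _ _ (a^-1 * (a + 1))) => //.
      exact: disk_continuous_cst.
    by move=> p _; rewrite ger0_norm // mulr_ge0.
  have dbi' : leb2.-integrable (subdisk (radius a n))
      (EFin \o (fun p => a^-1 * 2^-1 * Re (db (cpt p)))).
    exact: (integrableZl (ms n) (a^-1 * 2^-1) dbi).
  apply: (@le_trans _ _ (\int[leb2]_(p in subdisk (radius a n))
    ((a^-1 * (a + 1))%:E - (a^-1 * 2^-1 * Re (db (cpt p)))%:E)))%E.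
    apply: ge0_le_integral => //.
    - by move=> p _; rewrite lee_fin powR_ge0.
    - exact: measurable_funS mr.
    - exact: (measurable_int leb2 (integrableB (ms n) ci dbi')).
    - move=> p pn; rewrite -EFinB lee_fin.
      by apply: le_trans (ptw p (sub n p pn)) _; rewrite mulrBr mulrA.
  rewrite (integralB_EFin (ms n) ci dbi').
  have -> : (\int[leb2]_(x in subdisk (radius a n))
      (a^-1 * 2^-1 * Re (db (cpt x)))%:E =
    (a^-1 * 2^-1)%:E *
      \int[leb2]_(x in subdisk (radius a n)) (Re (db (cpt x)))%:E)%E.
    by rewrite -integralZl.
  have := MP _ (radius01 a0 n); rewrite radius_pow //.
  have := integrable_fin_num (ms n) dbi.
  rewrite /comp; case: (\int[leb2]_(x in _) _)%E => //= i _.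
  rewrite lee_fin => iM.
  have -> : (\int[leb2]_(x in subdisk (radius a n))
      (cst (a^-1 * (a + 1)) x)%:E =
     (a^-1 * (a + 1))%:E * leb2 (subdisk (radius a n)))%E.
    exact: (integral_cst leb2 (ms n) (a^-1 * (a + 1))%:E).
  apply: (@le_trans _ _ ((a^-1 * (a + 1))%:E * lD%:E - (a^-1 * 2^-1)%:E * i%:E)%E).
    apply: leeD => //; apply: lee_wpmul2l.
      by rewrite lee_fin mulr_ge0.
    by rewrite -lDE; apply: le_measure; rewrite ?inE.
  rewrite -!EFinM -EFinB lee_fin.
  have -> : a^-1 * (a + 1) * lD - a^-1 * 2^-1 * i =
    a^-1 * ((a + 1) * lD - 2^-1 * i) by ring.
  rewrite ler_wpM2l //.
  have : - i <= M * shrink n.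
    by apply: le_trans iM; rewrite -normrN ler_norm.
  have : M * shrink n <= M by rewrite ler_piMr // ltW // shrink_lt1.
  lra.
apply/integrableP; split => //.
apply: (@le_lt_trans _ _ K%:E); last exact: ltry.
have := @ge0_nondecreasing_set_cvg_integral _
  plane R (fun n => subdisk (radius a n))
  (EFin \o (fun p => rho (cpt p) `^ gamma)) leb2 (subdisk_radius_mono a0) ms.
rewrite (subdisk_radius_bigcup a0) => cvgI.
under eq_integral do rewrite gee0_abs ?lee_fin ?powR_ge0 //.
apply: cvge_le (cvgI _ _).
- by apply: nearW => n; exact: bnd.
- by move=> n; exact: measurable_funS mr.
- by move=> n p _; rewrite lee_fin powR_ge0.
Qed.

End weighted_integral.

(** * Linearity and estimates of the weighted disk integral *)

Section disk_integral_theory.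
Context {R : realType}.
Local Notation C := R[i].
Local Notation leb2 := (@lebesgue2 R).
Local Notation plane := (measurableTypeR R * measurableTypeR R)%type.
Implicit Types (p q : R * R) (z c : C) (f g : C -> C).

Let mD : measurable (@planar_disk R : set plane) := @measurable_planar_disk R.

(** The scaling rule holds for nonnegative functions; the positive and the negative part are scaled
    separately. *)
Lemma area_integral (f : plane -> \bar R) :
  leb2.-integrable (@planar_disk R) f ->
  (@area R).-integrable (@planar_disk R) f /\
  (\int[@area R]_(p in @planar_disk R) f p =
   ((fine (leb2 (@planar_disk R)))^-1)%:E * \int[leb2]_(p in @planar_disk R) f p)%E.
Proof.
move=> fi; have [mf fin] := integrableP _ _ _ fi.
have scale (g : plane -> \bar R) : measurable_fun (@planar_disk R : set plane) g ->
    (forall p, planar_disk p -> 0 <= g p)%E ->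
    (\int[@area R]_(p in @planar_disk R) g p =
   ((fine (leb2 (@planar_disk R)))^-1)%:E * \int[leb2]_(p in @planar_disk R) g p)%E.
  by move=> mg g0; rewrite /area ge0_integral_mscale.
split.
  apply/integrableP; split => //.
  rewrite scale //; last exact: measurableT_comp.
  by apply: lte_mul_pinfty => //; rewrite lee_fin invr_ge0 fine_ge0.
rewrite integralE [in RHS]integralE muleBr //; last first.
  by apply: fin_num_adde_defr; exact: (integrable_pos_fin_num mD fi).
rewrite !scale //; [exact: measurable_funeneg|exact: measurable_funepos].
Qed.

(** Positivity excludes the default value 0^-1 = 0 in [area], which would make it the zero
    measure. *)
Lemma lebesgue2_disk_gt0 : (0 < leb2 (@planar_disk R))%E.
Proof.
have mI : measurable (`[0%R, 2^-1%R]%classic : set (measurableTypeR R)).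
  exact: measurable_itv.
apply: (@lt_le_trans _ _ (leb2 (`[0%R, 2^-1%R] `*` `[0%R, 2^-1%R]))).
  have E : @lebesgue_measure R `[0%R, 2^-1%R]%classic = (2^-1)%:E.
    by rewrite lebesgue_measure_itv /= lte_fin invr_gt0 ltr0n -EFinB subr0.
  have -> : leb2 (`[0%R, 2^-1%R] `*` `[0%R, 2^-1%R]) = ((2^-1)%:E * (2^-1)%:E)%E.
    by rewrite -E; exact: product_measure1E.
  by rewrite -EFinM lte_fin mulr_gt0 ?invr_gt0.
apply: le_measure; rewrite ?inE //; first exact: measurableX.
move=> [x y] [] /=; rewrite !in_itv /= => /andP[x0 x1] /andP[y0 y1].
rewrite planar_diskE /=.
have : x ^+ 2 <= 2^-1 ^+ 2 by rewrite ler_pXn2r // nnegrE.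
have : y ^+ 2 <= 2^-1 ^+ 2 by rewrite ler_pXn2r // nnegrE.
by rewrite !expr2; lra.
Qed.

Variable gamma : R.
Hypotheses (gamma_gt : -1 < gamma) (gamma_le : gamma <= 0).

Let a0 : 0 < gamma + 1. Proof. by rewrite -ltrBlDr sub0r. Qed.

Lemma weightE z : weight gamma z = (gamma + 1) * rho z `^ gamma.
Proof. by rewrite rhoE. Qed.

Lemma weight_ge0 z : 0 <= weight gamma z.
Proof. by rewrite mulr_ge0 ?powR_ge0 // ltW. Qed.

Lemma weight_continuous : disk_continuous (fun p => weight gamma (cpt p)).
Proof.
have -> : (fun p => weight gamma (cpt p)) =
    (fun p => (gamma + 1) * rho (cpt p) `^ gamma).
  by apply/funext => p; rewrite weightE.
by apply: disk_continuousM; [exact: disk_continuous_cst|exact: disk_continuous_rho].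
Qed.

Lemma weight_integrable :
  leb2.-integrable (@planar_disk R) (EFin \o (fun p => weight gamma (cpt p))).
Proof.
have := integrableZl mD (gamma + 1) (rho_pow_integrable gamma_gt gamma_le).
by apply: eq_integrable => // p _ /=; rewrite weightE.
Qed.

Lemma weighted_integrable (u : R * R -> R) (K : R) : disk_continuous u ->
  (forall p, planar_disk p -> `|u p| <= K) ->
  leb2.-integrable (@planar_disk R) (EFin \o (fun p => u p * weight gamma (cpt p))).
Proof.
move=> cu uK.
apply: le_integrable (integrableZl mD K weight_integrable) => //.
  apply/measurable_EFinP; apply: disk_measurable.
  exact: disk_continuousM cu weight_continuous.
move=> p Dp /=; rewrite lee_fin !normrM ler_wpM2r //.
by apply: le_trans (uK p Dp) (ler_norm _).
Qed.

(** Boundedness makes the class stable under products and, as the weight is integrable, makes each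
    member integrable against it. *)
Definition admissible f := cdisk_continuous f /\
  exists K : R, forall z, unit_disk z -> normc (f z) <= K.

Lemma taylor1_admissible f f' : taylor1 unit_disk f f' -> admissible f.
Proof.
move=> ff'; split; first exact: taylor1_continuous ff'.
have [M M0 MP] := ff'; exists M => z Dz.
by have [] := MP z z Dz Dz.
Qed.

Lemma admissible_cst c : admissible (fun=> c).
Proof.
by split; [exact: cdisk_continuous_cst|exists (normc c)].
Qed.

Lemma admissibleD f g : admissible f -> admissible g ->
  admissible (fun z => f z + g z).
Proof.
move=> [cf [K Kf]] [cg [M Mg]]; split; first exact: cdisk_continuousD.
exists (K + M) => z Dz; apply: le_trans (ler_normcD _ _) _.
by rewrite lerD ?Kf ?Mg.
Qed.

Lemma admissibleM f g : admissible f -> admissible g ->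
  admissible (fun z => f z * g z).
Proof.
move=> [cf [K Kf]] [cg [M Mg]]; split; first exact: cdisk_continuousM.
by exists (K * M) => z Dz; rewrite normcM ler_pM ?normc_ge0 ?Kf ?Mg.
Qed.

Lemma admissibleJ f : admissible f -> admissible (fun z => (f z)^*%C).
Proof.
move=> [cf [K Kf]]; split; first exact: cdisk_continuousJ.
by exists K => z Dz; rewrite normc_conj Kf.
Qed.

Lemma admissible_Re f : admissible f -> leb2.-integrable (@planar_disk R)
  (EFin \o (fun p => Re (f (cpt p)) * weight gamma (cpt p))).
Proof.
move=> [[cr _] [K Kf]]; apply: (@weighted_integrable _ K) => // p Dp.
by apply: le_trans (norm_Re_le _) (Kf _ Dp).
Qed.

Lemma admissible_Im f : admissible f -> leb2.-integrable (@planar_disk R)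
  (EFin \o (fun p => Im (f (cpt p)) * weight gamma (cpt p))).
Proof.
move=> [[_ ci] [K Kf]]; apply: (@weighted_integrable _ K) => // p Dp.
by apply: le_trans (norm_Im_le _) (Kf _ Dp).
Qed.

Lemma Re_disk_integral f : Re (disk_integral gamma f) =
  \int[@area R]_(p in @planar_disk R) (Re (f (cpt p)) * weight gamma (cpt p)).
Proof. by []. Qed.

Lemma Im_disk_integral f : Im (disk_integral gamma f) =
  \int[@area R]_(p in @planar_disk R) (Im (f (cpt p)) * weight gamma (cpt p)).
Proof. by []. Qed.

Lemma eq_disk_integral f g : (forall z, unit_disk z -> f z = g z) ->
  disk_integral gamma f = disk_integral gamma g.
Proof.
move=> fg; apply/eqP; rewrite eq_complex; apply/andP.
by split; apply/eqP; apply: eq_Rintegral => p; rewrite inE => Dp; rewrite fg.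
Qed.

Lemma disk_integralD f g : admissible f -> admissible g ->
  disk_integral gamma (fun z => f z + g z) =
  disk_integral gamma f + disk_integral gamma g.
Proof.
move=> af ag; apply/eqP; rewrite eq_complex ReD ImD !Re_disk_integral
  !Im_disk_integral; apply/andP; split; apply/eqP.
- rewrite -RintegralD //.
  + by apply: eq_Rintegral => p _; rewrite ReD mulrDl.
  + by have [] := area_integral (admissible_Re af).
  + by have [] := area_integral (admissible_Re ag).
- rewrite -RintegralD //.
  + by apply: eq_Rintegral => p _; rewrite ImD mulrDl.
  + by have [] := area_integral (admissible_Im af).
  + by have [] := area_integral (admissible_Im ag).
Qed.

Lemma disk_integralZ c f : admissible f ->
  disk_integral gamma (fun z => c * f z) = c * disk_integral gamma f.
Proof.
move=> af.
have [ar _] := area_integral (admissible_Re af).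
have [ai _] := area_integral (admissible_Im af).
have zr d := integrableZl mD d ar; have zi d := integrableZl mD d ai.
apply/eqP; rewrite eq_complex Re_mulc Im_mulc !Re_disk_integral
  !Im_disk_integral; apply/andP; split; apply/eqP.
- rewrite -!RintegralZl // -RintegralB //.
  + by apply: eq_Rintegral => p _; rewrite Re_mulc; ring.
  + exact: zr.
  + exact: zi.
- rewrite -!RintegralZl // -RintegralD //.
  + by apply: eq_Rintegral => p _; rewrite Im_mulc; ring.
  + exact: zi.
  + exact: zr.
Qed.

Lemma disk_integralJ f : admissible f ->
  disk_integral gamma (fun z => (f z)^*%C) = (disk_integral gamma f)^*%C.
Proof.
move=> af; have [ai _] := area_integral (admissible_Im af).
apply/eqP; rewrite eq_complex ReJ ImJ !Re_disk_integral !Im_disk_integral.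
apply/andP; split; apply/eqP.
- by apply: eq_Rintegral => p _; rewrite ReJ.
- rewrite -mulN1r -RintegralZl //.
  by apply: eq_Rintegral => p _; rewrite ImJ; ring.
Qed.

Definition total_mass : R := Re (disk_integral gamma (fun=> 1%:C)).

Lemma disk_integral1 : disk_integral gamma (fun=> 1%:C) = total_mass%:C.
Proof.
apply/eqP; rewrite eq_complex eqxx /=; apply/eqP.
rewrite /Rintegral integral0_eq // => p _.
by rewrite /= mul0r.
Qed.

Lemma normc_disk_integral_le f (K : R) : admissible f ->
  (forall z, unit_disk z -> normc (f z) <= K) ->
  normc (disk_integral gamma f) <= 2 * (K * total_mass).
Proof.
move=> af fK.
have [a1 _] := area_integral (admissible_Re (admissible_cst 1%:C)).
have bound (u : R * R -> R) :
    (@area R).-integrable (@planar_disk R)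
      (EFin \o (fun p => u p * weight gamma (cpt p))) ->
    (forall p, planar_disk p -> `|u p| <= K) ->
    `|\int[@area R]_(p in @planar_disk R) (u p * weight gamma (cpt p))|
      <= K * total_mass.
  move=> iu uK; apply: le_trans (le_normr_Rintegral mD iu) _.
  rewrite /total_mass Re_disk_integral -RintegralZl //.
  apply: le_Rintegral => //.
  - exact: (integrable_norm iu).
  - exact: (integrableZl mD K a1).
  - move=> p Dp; rewrite normrM (ger0_norm (weight_ge0 _)) /= mul1r.
    by rewrite ler_wpM2r ?weight_ge0 ?uK.
apply: le_trans (normc_le_ReIm _) _; rewrite mulrDl mul1r.
rewrite Re_disk_integral Im_disk_integral; apply: lerD; apply: bound.
- by have [] := area_integral (admissible_Re af).
- by move=> p Dp; apply: le_trans (norm_Re_le _) (fK _ Dp).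
- by have [] := area_integral (admissible_Im af).
- by move=> p Dp; apply: le_trans (norm_Im_le _) (fK _ Dp).
Qed.

(** For gamma <= 0 and 0 < rho <= 1 the weight is at least gamma + 1 > 0, and the disk has [area]
    1. *)
Lemma total_mass_gt0 : 0 < total_mass.
Proof.
have [a1 _] := area_integral (admissible_Re (admissible_cst 1%:C)).
have D1 : area (@planar_disk R) = 1%E.
  rewrite /area /mscale /=.
  have f : leb2 (@planar_disk R) \is a fin_num.
    by rewrite ge0_fin_numE // lebesgue2_disk_lt.
  rewrite -[X in (_ * X)%E]fineK // -EFinM mulVf // gt_eqF //.
  by rewrite fine_gt0 // lebesgue2_disk_gt0 lebesgue2_disk_lt.
rewrite /total_mass Re_disk_integral.
apply: lt_le_trans a0 _.
have -> : gamma + 1 = \int[@area R]_(p in @planar_disk R) (gamma + 1).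
  rewrite Rintegral_cst // -[LHS]mulr1; congr (_ * _).
  exact: (esym (congr1 fine D1)).
apply: le_Rintegral => //.
  apply/integrableP; split; first exact: measurable_cst.
  have -> : (\int[@area R]_(p in @planar_disk R) `|(EFin \o cst (gamma + 1)%R) p|
      = `|(gamma + 1)%R%:E| * area (@planar_disk R))%E.
    exact: (integral_cst (@area R) mD `|(gamma + 1)%R%:E|%E).
  by rewrite D1 mule1 ltry.
move=> p Dp; rewrite /= mul1r weightE ler_peMr ?(ltW a0) //.
have r0 := rho_gt0 (Dp : unit_disk (cpt p)).
have <- : 1 `^ gamma = 1 :> R by rewrite powR1.
exact: powR_le_neg gamma_le r0 (rho_le1 _).
Qed.

(** Since [f] is bounded, a multiple of the weight dominates the integrand, and the boundary terms
    on the subdisks tend to 0. *)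
Lemma disk_integral_dbar (h h' L L' f : C -> C) :
  taylor1 unit_disk h h' -> taylor1 unit_disk L L' -> admissible f ->
  (forall z, unit_disk z -> dbar gamma h L L' z = f z * (weight gamma z)%:C) ->
  disk_integral gamma f = 0.
Proof.
move: h h' L L' f.
have key (h h' L L' f : C -> C) :
    taylor1 unit_disk h h' -> taylor1 unit_disk L L' -> admissible f ->
    (forall z, unit_disk z -> dbar gamma h L L' z = f z * (weight gamma z)%:C) ->
    Re (disk_integral gamma f) = 0.
  move=> hh' LL' af fE.
  have [_ aE] := area_integral (admissible_Re af).
  rewrite Re_disk_integral /Rintegral aE.
  have [M M0 MP] := dbar_subdisk_bound gamma_gt gamma_le hh' LL'.
  have [cd _] := dbar_continuous gamma hh' LL'.
  have [_ [K Kf]] := af.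
  have dE p : planar_disk p -> Re (dbar gamma h L L' (cpt p)) =
      Re (f (cpt p)) * weight gamma (cpt p).
    by move=> Dp; rewrite fE // Re_mulc /= mulr0 subr0.
  have := @integral_disk_eq0 R _ a0 (fun p => Re (dbar gamma h L L' (cpt p)))
    (fun p => K * weight gamma (cpt p)) M cd _ _ MP.
  move=> /(_ (integrableZl mD K weight_integrable)) I0.
  have -> : (\int[leb2]_(p in @planar_disk R)
      (EFin \o (fun p => (Re (f (cpt p)) * weight gamma (cpt p))%R)) p =
      \int[leb2]_(p in @planar_disk R) (Re (dbar gamma h L L' (cpt p)))%:E)%E.
    by apply: eq_integral => p; rewrite inE => Dp; rewrite /= dE.
  rewrite I0 ?mule0 // => p Dp.
  rewrite dE // normrM (ger0_norm (weight_ge0 _)) ler_wpM2r ?weight_ge0 //.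
  by apply: le_trans (norm_Re_le _) (Kf _ Dp).
move=> h h' L L' f hh' LL' af fE; apply/eqP.
rewrite eq_complex (key h h' L L') //= eqxx /=.
pose i : C := 'i%C.
(* [dbar] is linear in [h], and the real part of -i X is Im X: the imaginary part reduces to the
   real one. *)
have hh'i : taylor1 unit_disk (fun z => - i * h z) (fun z => 0 * h z + - i * h' z).
  exact: taylor1M (taylor1_cst _ (- i)) hh'.
have := key _ _ _ _ (fun z => - i * f z) hh'i LL'.
move=> /(_ (admissibleM (admissible_cst (- i)) af)) H.
have : Re (disk_integral gamma (fun z => - i * f z)) = 0.
  apply: H => z Dz; rewrite -mulrA -fE // /dbar; ring.
by rewrite disk_integralZ // Re_mulc /= oppr0 mul0r sub0r mulN1r opprK => ->.
Qed.

End disk_integral_theory.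

(** * The reproducing property *)

Section reproducing.
Context {R : realType}.
Local Notation C := R[i].
Implicit Types (z w xi : C) (f g h : C -> C).

Lemma taylor1_sum (n : nat) (F F' : nat -> C -> C) (A : set C) :
  (forall j, (j < n)%N -> taylor1 A (F j) (F' j)) ->
  taylor1 A (fun z => \sum_(0 <= j < n) F j z)
    (fun z => \sum_(0 <= j < n) F' j z).
Proof.
elim: n => [|n IHn] FF'.
  apply: eq_taylor1 (taylor1_cst A 0) => z _; by rewrite big_geq.
apply: eq_taylor1 (taylor1D (IHn _) (FF' n _)) => [z _|z _|j jn|] //.
- by rewrite big_nat_recr.
- by rewrite big_nat_recr.
- by apply: FF'; rewrite ltnS ltnW.
Qed.

Lemma normc_sum_le (n : nat) (F : nat -> C) (B : R) :
  (forall j, (j < n)%N -> normc (F j) <= B) ->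
  normc (\sum_(0 <= j < n) F j) <= n%:R * B.
Proof.
elim: n => [|n IHn] FB.
  by rewrite big_geq // mul0r ComplexField.Normc.normc0.
rewrite big_nat_recr //= -natr1 mulrDl mul1r.
apply: le_trans (ler_normcD _ _) _; apply: lerD; last exact: FB.
by apply: IHn => j jn; apply: FB; rewrite ltnS ltnW.
Qed.

Lemma taylor1_affine (c d : C) :
  taylor1 unit_disk (fun z => c + d * z) (cst d).
Proof.
apply: eq_taylor1 (taylor1D (taylor1_cst _ c)
  (taylor1M (taylor1_cst _ d) (@taylor1_id R))) => z _ //=.
by rewrite /cst /= mul0r add0r mulr1 add0r.
Qed.

Lemma segment_in_disk (t : R) xi w : 0 <= t <= 1 -> unit_disk xi ->
  unit_disk w -> unit_disk ((1 - t)%:C * xi + t%:C * w).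
Proof.
move=> /andP[t0 t1]; rewrite !unit_diskE => xi1 w1.
have [->|tn0] := eqVneq t 0.
  by rewrite subr0 mul1r mul0r addr0.
apply: le_lt_trans (ler_normcD _ _) _; rewrite !normcM !normc_real.
rewrite !ger0_norm ?subr_ge0 //.
have tp : 0 < t by rewrite lt_neqAle eq_sym tn0.
have : t * normc w < t * 1 by rewrite ltr_pM2l.
have : (1 - t) * normc xi <= (1 - t) * 1 by rewrite ler_wpM2l ?subr_ge0 // ltW.
lra.
Qed.

(* Riemann sums for [h w = \int_0^1 f' (xi + t (w - xi)) dt], which satisfies
   [f w - f xi = (w - xi) * h w]. *)
Definition slope_sum (f' : C -> C) xi (n : nat) w : C :=
  n%:R^-1%:C * \sum_(0 <= j < n)
    f' ((1 - j%:R / n%:R)%:C * xi + (j%:R / n%:R)%:C * w).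

Let ratio01 (j n : nat) : (j <= n)%N -> 0 <= (j%:R / n%:R : R) <= 1.
Proof.
(* For n = 0 the quotient takes the default value 0, which is in [0, 1]. *)
move=> jn; case: n jn => [|n] jn; first by rewrite mulr0n invr0 mulr0 lexx ler01.
by rewrite divr_ge0 //= ler_pdivrMr // mul1r ler_nat.
Qed.

Lemma taylor1_slope_sum (f f' : C -> C) xi n : unit_disk xi ->
  taylor1 unit_disk f f' -> exists g', taylor1 unit_disk (slope_sum f xi n) g'.
Proof.
move=> Dxi ff'; eexists; apply: taylor1M; first exact: taylor1_cst.
apply: (@taylor1_sum n
  (fun j w => f ((1 - j%:R / n%:R)%:C * xi + (j%:R / n%:R)%:C * w))) => j jn.
apply: (taylor1_comp _ ff' (taylor1_affine _ _)) => z Dz.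
by apply: segment_in_disk => //; exact/ratio01/ltnW.
Qed.

(** The increment of [f] telescopes over N = n + 1 equal steps of the segment. Each step has length
    at most 2 / N, so its remainder is at most M (2 / N)^2, and N of them add up to 4 M / N,
    uniformly in [w]. *)
Lemma slope_sum_approx f f' xi : unit_disk xi -> taylor1 unit_disk f f' ->
  exists2 M : R, 0 <= M & forall n w, unit_disk w ->
    normc (f w - f xi - (w - xi) * slope_sum f' xi n.+1 w) <= M / n.+1%:R.
Proof.
move=> Dxi [M M0 MP]; exists (M * 4) => [|n w Dw]; first by rewrite mulr_ge0.
set N : R := n.+1%:R; have N0 : 0 < N by rewrite ltr0n.
pose z j : C := (1 - j%:R / N)%:C * xi + (j%:R / N)%:C * w.
have Dz j : (j <= n.+1)%N -> unit_disk (z j).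
  by move=> jn; apply: segment_in_disk => //; exact: ratio01.
have zB j : z j.+1 - z j = N^-1%:C * (w - xi).
  rewrite /z -[j.+1%:R]natr1 mulrDl mul1r !(rmorphB, rmorphD) /=; ring.
have zn : z n.+1 = w.
  by rewrite /z divff ?gt_eqF // subrr mul0r add0r mul1r.
have z0 : z 0%N = xi.
  by rewrite /z mul0r subr0 mul1r mul0r addr0.
have -> : f w - f xi - (w - xi) * slope_sum f' xi n.+1 w =
    \sum_(0 <= j < n.+1) (f (z j.+1) - f (z j) - f' (z j) * (z j.+1 - z j)).
  rewrite sumrB telescope_sumr // zn z0; congr (_ - _).
  rewrite /slope_sum mulrCA mulrA mulr_sumr; apply: eq_bigr => j _.
  by rewrite zB mulrC.
have -> : M * 4 / N = N * (M * (2 / N) ^+ 2).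
  by field; rewrite gt_eqF.
apply: normc_sum_le => j jn.
have [_ _ _ m] := MP (z j) (z j.+1) (Dz j (ltnW jn)) (Dz j.+1 jn).
apply: le_trans m _; rewrite ler_wpM2l // ler_pXn2r ?nnegrE ?normc_ge0 //;
  last by rewrite divr_ge0 // ltW.
rewrite zB normcM normc_real ger0_norm ?invr_ge0 ?(ltW N0) // mulrC.
rewrite ler_wpM2r ?invr_ge0 ?(ltW N0) //.
apply: le_trans (ler_normcB _ _) _.
by rewrite -[2]/(1 + 1) lerD // ltW // -unit_diskE.
Qed.

Lemma taylor1_npow_comp (s : R) (q q' : C -> C) (r : R) : 0 <= r < 1 ->
  taylor1 unit_disk q q' -> (forall z, unit_disk z -> normc (q z - 1) <= r) ->
  taylor1 unit_disk (fun z => npow s (q z))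
    (fun z => - s%:C * (npow s (q z) * (q z)^-1) * q' z).
Proof.
move=> r01 qq' qr.
exact: (taylor1_comp qr (taylor1_npow s r01) qq').
Qed.

Lemma taylor1_inv_comp (q q' : C -> C) (a : R) : 0 < a ->
  taylor1 unit_disk q q' -> (forall z, unit_disk z -> a <= normc (q z)) ->
  taylor1 unit_disk (fun z => (q z)^-1) (fun z => - ((q z)^-1 * (q z)^-1) * q' z).
Proof. by move=> a0 qq' qa; exact: (taylor1_comp qa (taylor1_inv a0) qq'). Qed.

(** The second expansion makes the Riemann sums of f' differentiable, as Stokes' formula demands of
    [h]. *)
Definition twice_taylor f := exists f' f'' : C -> C,
  taylor1 unit_disk f f' /\ taylor1 unit_disk f' f''.

Lemma twice_taylor_npow_comp (s : R) (q : C -> C) (r : R) : 0 <= r < 1 ->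
  twice_taylor q -> (forall z, unit_disk z -> normc (q z - 1) <= r) ->
  twice_taylor (fun z => npow s (q z)).
Proof.
move=> r01 [q' [q'' [qq' qq'']]] qr.
have P := taylor1_npow_comp s r01 qq' qr.
have r0 : 0 < 1 - r by rewrite subr_gt0; case/andP: r01.
have I := taylor1_inv_comp r0 qq' _.
exists (fun z => - s%:C * (npow s (q z) * (q z)^-1) * q' z); eexists; split => //.
apply: taylor1M qq''; apply: taylor1M; first exact: taylor1_cst.
apply: taylor1M P (I _) => z Dz.
by have /andP[] := disk1_norm (qr z Dz).
Qed.

Section kernel.
Variables (gamma : R) (xi : C).
Hypotheses (gamma_gt : -1 < gamma) (gamma_le : gamma <= 0).
Hypothesis Dxi : unit_disk xi.

Definition rkernel z : C := npow (gamma + 2) (1 - xi^*%C * z).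

Let xi01 : 0 <= normc xi < 1.
Proof. by rewrite normc_ge0 -unit_diskE. Qed.

Let q_le z : unit_disk z -> normc (1 - xi^*%C * z - 1) <= normc xi.
Proof.
move=> Dz; rewrite addrAC subrr add0r normc_opp normcM normc_conj.
by rewrite ler_piMr ?normc_ge0 // ltW // -unit_diskE.
Qed.

Let q_taylor : taylor1 unit_disk (fun z => 1 - xi^*%C * z) (cst (- xi^*%C)).
Proof.
by apply: eq_taylor1 (taylor1_affine 1 (- xi^*%C)) => z _ //; rewrite mulNr.
Qed.

Let q_neq0 z : unit_disk z -> 1 - xi^*%C * z != 0.
Proof.
move=> Dz; rewrite -normc_gt0; apply: normc_one_minus_gt0.
by apply: normc_mul_lt1; rewrite ?normc_conj -unit_diskE.
Qed.

Lemma twice_taylor_rkernel : twice_taylor rkernel.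
Proof.
apply: (twice_taylor_npow_comp (gamma + 2) xi01 _ q_le).
by exists (cst (- xi^*%C)), (cst 0); split => //; exact: taylor1_cst.
Qed.

Let rkernel_taylor : taylor1 unit_disk rkernel
  (fun z => - (gamma + 2)%:C * (rkernel z * (1 - xi^*%C * z)^-1) * - xi^*%C).
Proof. exact: (taylor1_npow_comp (gamma + 2) xi01 q_taylor q_le). Qed.

Let qk_taylor : taylor1 unit_disk (fun z => (1 - xi^*%C * z) * rkernel z)
  (fun z => (gamma + 1)%:C * xi^*%C * rkernel z).
Proof.
apply: eq_taylor1 (taylor1M q_taylor rkernel_taylor) => z Dz //.
rewrite /cst !rmorphD /=; field; exact: q_neq0.
Qed.

Let rkernel_admissible : admissible rkernel.
Proof. exact: taylor1_admissible rkernel_taylor. Qed.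

Lemma disk_integral_vanish h h' : taylor1 unit_disk h h' ->
  disk_integral gamma (fun z => (z - xi) * h z * (rkernel z)^*%C) = 0.
Proof.
move=> hh'.
have ah := taylor1_admissible hh'.
have az : admissible (fun z : C => z - xi).
  apply: admissibleD (admissible_cst (- xi)).
  exact: taylor1_admissible (@taylor1_id R).
have a1 := admissibleM (admissibleM az ah) (admissibleJ rkernel_admissible).
(* The factor -2: [dbar] is twice the conjugate derivative, and it produces xi - z instead of z -
   xi. *)
have := disk_integral_dbar gamma_gt gamma_le hh' qk_taylor
  (admissibleM (admissible_cst (- 2%:C)) a1).
rewrite disk_integralZ // => H.
have n2 : - 2%:C != 0 :> C by rewrite oppr_eq0 eq_complex /= pnatr_eq0.
apply: (mulfI n2); rewrite mulr0; apply: H => z Dz.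
have cL : ((1 - xi^*%C * z) * rkernel z)^*%C =
    (1 - xi * z^*%C) * (rkernel z)^*%C.
  by rewrite conjcM (rmorphB conjc) (rmorph1 conjc) /= conjcM conjcK.
have cL' : ((gamma + 1)%:C * xi^*%C * rkernel z)^*%C =
    (gamma + 1)%:C * xi * (rkernel z)^*%C.
  by rewrite !conjcM conjc_real conjcK.
have rhoC : (rho z)%:C = 1 - z * z^*%C.
  rewrite /rho; case: z {Dz cL cL'} => x y.
  by apply/eqP; rewrite eq_complex /=; apply/andP; split; apply/eqP; ring.
rewrite /dbar weightE rho_powS // cL cL'.
rewrite !(rmorphM (real_complex R)) /= rhoC.
(* The computation rests on xi (1 - z zc) - z (1 - xi zc) = xi - z. *)
move: (rkernel z)^*%C z^*%C (_ `^ _)%:C (gamma + 1)%:C => k zc e b.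
by ring.
Qed.

Lemma disk_integral_rkernel f : twice_taylor f ->
  disk_integral gamma (fun z => f z * (rkernel z)^*%C) =
  f xi * disk_integral gamma (fun z => (rkernel z)^*%C).
Proof.
move=> [f' [f'' [ff' f'f'']]].
have ak := admissibleJ rkernel_admissible; have [_ [N kN]] := ak.
have af := taylor1_admissible ff'.
have [M M0 approx] := slope_sum_approx Dxi ff'.
have N0 : 0 <= N by apply: le_trans (kN xi Dxi); exact: normc_ge0.
have c0 := total_mass_gt0 gamma_gt gamma_le.
set X := LHS; set Y := RHS.
have XY n : normc (X - Y) <= 2 * (M * N * total_mass gamma) / n.+1%:R.
  have [g' hg'] := taylor1_slope_sum n.+1 Dxi f'f''.
  set h := slope_sum f' xi n.+1 in hg' approx.
  have ah := taylor1_admissible hg'.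
  have az : admissible (fun z : C => z - xi).
    apply: admissibleD (admissible_cst (- xi)).
    exact: taylor1_admissible (@taylor1_id R).
  have azh := admissibleM az ah.
  have azhk := admissibleM azh ak.
  have an1 := admissibleM (admissible_cst (-1 : C)) azh.
  have ar := admissibleD (admissibleD af (admissible_cst (- f xi))) an1.
  have ark := admissibleM ar ak.
  (* The integral of (z - xi) h conj(K) vanishes and can be subtracted freely; what remains is the
     approximation error against conj(K). *)
  have -> : X - Y = disk_integral gamma
      (fun z => (f z + - f xi + -1 * ((z - xi) * h z)) * (rkernel z)^*%C).
    apply/eqP; rewrite subr_eq; apply/eqP; rewrite /X /Y.
    have afk := admissibleM (admissible_cst (f xi)) ak.
    rewrite -disk_integralZ // -disk_integralD //.
    rewrite -[RHS]addr0 -(disk_integral_vanish hg') -disk_integralD //;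
      last exact: admissibleD.
    by apply: eq_disk_integral => z _; ring.
  have -> : 2 * (M * N * total_mass gamma) / n.+1%:R =
    2 * (M / n.+1%:R * N * total_mass gamma) by ring.
  apply: normc_disk_integral_le => // z Dz.
  rewrite normcM; apply: ler_pM; rewrite ?normc_ge0 ?kN //.
  by rewrite mulN1r; apply: approx.
(* [X - Y] does not depend on [n] but is bounded by a constant over n + 1, so the Archimedean
   property makes it 0. *)
apply/eqP; rewrite -subr_eq0 -normc_eq0 eq_le normc_ge0 andbT leNgt.
apply/negP => x0.
set A := 2 * _ in XY.
have A0 : 0 <= A by rewrite !mulr_ge0 // ltW.
have e0 : 0 < normc (X - Y) / (A + 1) by rewrite divr_gt0 // ltr_wpDl.
have [n _ nP] := near_infty_natSinv_lt (PosNum e0).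
have := nP n (leqnn n); rewrite /= ltr_pdivlMr ?ltr_wpDl // => h.
have := XY n; rewrite leNgt => /negP; apply.
apply: le_lt_trans h; rewrite mulrC ler_wpM2l ?invr_ge0 //.
by rewrite lerDl.
Qed.

End kernel.
End reproducing.

(** * The Berezin transform of a disk automorphism *)

Section berezin.
Context {R : realType}.
Local Notation C := R[i].
Implicit Types (z w xi beta : C) (f g h : C -> C) (s : R).

Lemma npow_conj s z : npow s z^*%C = (npow s z)^*%C.
Proof.
case: z => x y; rewrite /npow /= sqrrN [- y / x]mulNr atanN mulrN cosN sinN mulrN.
by [].
Qed.

Lemma npow_pos_real s (x : R) : 0 < x -> npow s x%:C = (x `^ (- s))%:C.
Proof.
move=> x0; rewrite /npow /= mul0r atan0 mulr0 cos0 sin0 mulr0 oppr0 mulr1.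
rewrite expr0n addr0 lnXn // /powR gt_eqF // -[ln x *+ 2]mulr_natl.
by congr ((expR _) +i* 0); field.
Qed.

Lemma normc_npow_powR s z : z != 0 -> normc (npow s z) = normc z `^ (- s).
Proof.
rewrite -normc_gt0 => z0; rewrite normc_npow -normc_sqr lnXn //.
by rewrite /powR gt_eqF // -[ln _ *+ 2]mulr_natl; congr expR; field.
Qed.

(* For [0 < s <= 2] the power [- s] maps the half-plane into the plane slit
   along the negative half-axis. *)
Lemma Im_npow_eq0 s z : 0 < s <= 2 -> 0 < Re z -> Im (npow s z) = 0 -> Im z = 0.
Proof.
move=> /andP[s0 s2] z0; rewrite /npow /=; set th := s * atan _.
move=> /eqP; rewrite oppr_eq0 mulf_eq0 gt_eqF ?expR_gt0 //= => /eqP sin0.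
have a1 := atan_ltpi2 (Im z / Re z); have a2 := atan_gtNpi2 (Im z / Re z).
(* Since |atan| < pi/2 and s <= 2, the angle [th] lies in ]-pi, pi[, where the sine vanishes only at
   0. *)
have t1 : th < pi.
  have [a0|a0] := ltP 0 (atan (Im z / Re z)).
    apply: le_lt_trans (_ : 2 * atan (Im z / Re z) < _); last lra.
    by rewrite ler_pM2r.
  by apply: le_lt_trans (pi_gt0 R); rewrite mulr_ge0_le0 // ltW.
have t2 : - th < pi.
  have [a0|a0] := ltP (atan (Im z / Re z)) 0.
    rewrite -mulrN; apply: le_lt_trans (_ : 2 * - atan (Im z / Re z) < _); last lra.
    by rewrite ler_pM2r // oppr_gt0.
  apply: le_lt_trans (pi_gt0 R); rewrite oppr_le0 mulr_ge0 //; exact: ltW.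
have th0 : th = 0.
  have [t0|t0|//] := ltrgtP th 0.
    have : 0 < sin (- th) by apply: sin_gt0_pi; rewrite t2 oppr_gt0 t0.
    by rewrite sinN sin0 oppr0 ltxx.
  have : 0 < sin th by apply: sin_gt0_pi; rewrite t1 t0.
  by rewrite sin0 ltxx.
move/eqP: th0; rewrite mulf_eq0 gt_eqF //= => /eqP at0.
have : tan (atan (Im z / Re z)) = 0 by rewrite at0 tan0.
rewrite atanK => /eqP; rewrite mulf_eq0 invr_eq0 (gt_eqF z0) orbF.
by move/eqP.
Qed.

Section operators.
Variable gamma : R.
Hypotheses (gamma_gt : -1 < gamma) (gamma_le : gamma <= 0).

(** Membership has to be established wherever [to_bergman] is used, because it returns the zero
    function otherwise. *)
Lemma taylor1_in_bergman f f' : taylor1 unit_disk f f' -> in_bergman gamma f.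
Proof.
move=> ff'; split; first exact: taylor1_derivable ff'.
have af := taylor1_admissible ff'.
have [+ _] := area_integral (admissible_Re gamma_gt gamma_le
  (admissibleM af (admissibleJ af))).
move=> /integrableP[_]; apply: le_lt_trans; rewrite le_eqVlt; apply/orP; left.
apply/eqP; apply: eq_integral => p _ /=.
have -> : Re (f (cpt p) * (f (cpt p))^*%C) = normc (f (cpt p)) ^+ 2.
  by rewrite normc_sqr Re_mulc ReJ ImJ; ring.
by rewrite ger0_norm // mulr_ge0 ?exprn_ge0 ?normc_ge0 // weight_ge0.
Qed.

Lemma to_bergmanE f : in_bergman gamma f -> sval (to_bergman gamma f) = f.
Proof. by move=> fA; rewrite /to_bergman; case: pselect. Qed.

Lemma kernel_funE xi z : unit_disk xi -> unit_disk z ->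
  kernel_fun gamma xi z =
  ((1 - normc xi ^+ 2) `^ ((gamma + 2) / 2))%:C * rkernel gamma xi z.
Proof.
rewrite !unit_diskE => xi1 z1; rewrite /kernel_fun /rkernel npowE //.
have : normc (xi^*%C * z) < 1 by apply: normc_mul_lt1; rewrite ?normc_conj.
have := norm_Re_le (xi^*%C * z); rewrite ler_norml => /andP[_ h] h1.
by rewrite ReD ReN /= subr_gt0; apply: le_lt_trans h h1.
Qed.

Lemma taylor1_kernel_fun xi : unit_disk xi ->
  exists f' , taylor1 unit_disk (kernel_fun gamma xi) f'.
Proof.
move=> Dxi; have [f' [_ [ff' _]]] := twice_taylor_rkernel gamma Dxi.
eexists; apply: eq_taylor1 (taylor1M (taylor1_cst unit_disk
  ((1 - normc xi ^+ 2) `^ ((gamma + 2) / 2))%:C) ff') => z Dz //.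
by rewrite kernel_funE.
Qed.

Lemma rkernel_at0 xi : rkernel gamma xi 0 = 1.
Proof.
rewrite /rkernel mulr0 subr0 -[1 : C]/(1%:C) npow_pos_real //.
by rewrite powR1.
Qed.

Lemma rkernel0 z : rkernel gamma 0 z = 1.
Proof.
rewrite /rkernel; have -> : (0 : C)^*%C = 0 by exact: conjc0.
by rewrite mul0r subr0 -[1 : C]/(1%:C) npow_pos_real // powR1.
Qed.

(** The kernel at 0 is the constant 1, so the reproducing formula at 0, applied to the kernel at
    [xi], says that its integral is its value 1 at 0 times the total mass. *)
Lemma disk_integral_rkernel_conj xi : unit_disk xi ->
  disk_integral gamma (fun z => (rkernel gamma xi z)^*%C) =
  (total_mass gamma)%:C.
Proof.
move=> Dxi; have D0 : unit_disk (0 : C).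
  by rewrite unit_diskE ComplexField.Normc.normc0.
have tk := twice_taylor_rkernel gamma Dxi.
have [f' [_ [ff' _]]] := tk.
rewrite disk_integralJ //; last exact: taylor1_admissible ff'.
have := disk_integral_rkernel gamma_gt gamma_le D0 tk.
rewrite rkernel_at0 mul1r.
have one : forall z : C, unit_disk z -> (rkernel gamma 0 z)^*%C = 1%:C.
  by move=> z _; rewrite rkernel0 conjc1.
rewrite (eq_disk_integral gamma one) disk_integral1.
rewrite (@eq_disk_integral _ _ _ (rkernel gamma xi)); last first.
  by move=> z Dz; rewrite one // mulr1.
by move=> ->; rewrite conjc_real.
Qed.

Variable beta : C.
Hypothesis Dbeta : unit_disk beta.

Let beta1 : normc beta < 1. Proof. by rewrite -unit_diskE. Qed.

Let den_neq0 z : unit_disk z -> 1 - beta^*%C * z != 0.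
Proof.
move=> Dz; rewrite -normc_gt0; apply: normc_one_minus_gt0.
by apply: normc_mul_lt1; rewrite ?normc_conj -unit_diskE.
Qed.

Lemma psi1_disk z : unit_disk z -> unit_disk (psi1 beta z).
Proof.
move=> Dz; have z1 : normc z < 1 by rewrite -unit_diskE.
have d0 := den_neq0 Dz; rewrite unit_diskE /psi1 normcM normcV.
rewrite ltr_pdivrMr ?normc_gt0 // mul1r.
rewrite -(@ltr_pXn2r _ 2) ?nnegrE ?normc_ge0 // -subr_gt0.
have -> : normc (1 - beta^*%C * z) ^+ 2 - normc (z - beta) ^+ 2 =
    (1 - normc z ^+ 2) * (1 - normc beta ^+ 2).
  rewrite !normc_sqr; case: (z) (beta) => x y [c d] /=; ring.
by rewrite mulr_gt0 // subr_gt0 expr_lt1 ?normc_ge0.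
Qed.

Lemma twice_taylor_psi1 : twice_taylor (psi1 beta).
Proof.
have q : taylor1 unit_disk (fun z => 1 - beta^*%C * z) (cst (- beta^*%C)).
  by apply: eq_taylor1 (taylor1_affine 1 (- beta^*%C)) => z _ //; rewrite mulNr.
have b0 : 0 < 1 - normc beta by rewrite subr_gt0.
have I := taylor1_inv_comp b0 q _.
have {}I : taylor1 unit_disk (fun z => (1 - beta^*%C * z)^-1)
  (fun z => - ((1 - beta^*%C * z)^-1 * (1 - beta^*%C * z)^-1) * - beta^*%C).
  apply: I => z Dz; have := ler_normcD (1 - beta^*%C * z) (beta^*%C * z).
  rewrite subrK ComplexField.Normc.normc1 normcM normc_conj.
  have : normc beta * normc z <= normc beta.
    by rewrite ler_piMr ?normc_ge0 // ltW // -unit_diskE.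
  lra.
have N : taylor1 unit_disk (fun z => z - beta) (cst 1).
  by apply: eq_taylor1 (taylor1_affine (- beta) 1) => z _ //; rewrite mul1r addrC.
do 2 eexists; split; first exact: (taylor1M N I).
apply: taylor1D.
  apply: taylor1M I; exact: taylor1_cst.
apply: taylor1M N _.
apply: eq_taylor1 (taylor1M (taylor1_cst _ beta^*%C) (taylor1M I I)) => z _ //.
by rewrite /cst mulrN mulNr opprK mulrC.
Qed.

(** The reproducing formula evaluates the composed kernel at [xi]; the two normalizing factors, each
    of exponent (gamma + 2) / 2, merge into one. *)
Lemma berezin_psi1E xi : unit_disk xi ->
  berezin_transform (composition_operator gamma (psi1 beta)) xi =
  (total_mass gamma * (1 - normc xi ^+ 2) `^ (gamma + 2))%:C *
  npow (gamma + 2) (1 - xi^*%C * psi1 beta xi).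
Proof.
move=> Dxi; have xi1 : normc xi < 1 by rewrite -unit_diskE.
have x0 : 0 < 1 - normc xi ^+ 2 by rewrite subr_gt0 expr_lt1 ?normc_ge0.
set K := ((1 - normc xi ^+ 2) `^ ((gamma + 2) / 2)).
have [k' kk'] := taylor1_kernel_fun Dxi.
have [psi' [psi'' [pp' p'p'']]] := twice_taylor_psi1.
have kA : in_bergman gamma (kernel_fun gamma xi) by exact: taylor1_in_bergman kk'.
have kpA : in_bergman gamma (kernel_fun gamma xi \o psi1 beta).
  by apply: taylor1_in_bergman (taylor1_comp psi1_disk kk' pp').
have fT : twice_taylor (fun z => rkernel gamma xi (psi1 beta z)).
  apply: (@twice_taylor_npow_comp _ (gamma + 2) _ (normc xi)).
  - by rewrite normc_ge0.
  - exists (fun z => - xi^*%C * psi' z), (fun z => - xi^*%C * psi'' z); split.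
    + apply: eq_taylor1 (taylor1D (taylor1_cst _ 1)
        (taylor1M (taylor1_cst _ (- xi^*%C)) pp')) => z _.
        by rewrite /cst mulNr.
      by rewrite /cst mul0r !add0r.
    + apply: eq_taylor1 (taylor1M (taylor1_cst _ (- xi^*%C)) p'p'') => z _ //.
      by rewrite /cst mul0r add0r.
  - move=> z Dz; rewrite addrAC subrr add0r normc_opp normcM normc_conj.
    rewrite ler_piMr ?normc_ge0 // ltW // -unit_diskE; exact: psi1_disk.
rewrite /berezin_transform /bergman_inner /normalized_kernel.
rewrite /composition_operator (to_bergmanE kA) (to_bergmanE kpA).
have [f' [_ [ff' _]]] := fT.
have [r' [_ [rr' _]]] := twice_taylor_rkernel gamma Dxi.
have ae := admissibleM (taylor1_admissible ff')
  (admissibleJ (taylor1_admissible rr')).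
rewrite (@eq_disk_integral _ _ _ (fun z => (K * K)%:C *
    (rkernel gamma xi (psi1 beta z) * (rkernel gamma xi z)^*%C))); last first.
  move=> z Dz.
  rewrite -[LHS]/(kernel_fun gamma xi (psi1 beta z) * (kernel_fun gamma xi z)^*%C).
  rewrite !kernel_funE //; last exact: psi1_disk.
  by rewrite conjcM conjc_real rmorphM /=; ring.
rewrite disk_integralZ // disk_integral_rkernel // disk_integral_rkernel_conj //.
have -> : K * K = (1 - normc xi ^+ 2) `^ (gamma + 2).
  rewrite -powRD; last by rewrite (gt_eqF x0) implybT.
  by congr (_ `^ _); field.
by rewrite rmorphM /=; rewrite /rkernel; ring.
Qed.

End operators.
End berezin.

(** * Real values and conjugate points of the Berezin range *)

Section range.
Context {R : realType}.
Local Notation C := R[i].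
Implicit Types (z w xi beta : C).
Variables (gamma : R) (beta : C).
Hypotheses (gamma_gt : -1 < gamma) (gamma_le : gamma <= 0).
Hypothesis Dbeta : unit_disk beta.

Local Notation Ber :=
  (berezin_transform (composition_operator gamma (psi1 beta))).

Let s := gamma + 2.
Let c0 := total_mass gamma.
Let c0_gt0 : 0 < c0. Proof. exact: total_mass_gt0. Qed.
Let s_gt0 : 0 < s. Proof. by rewrite /s; move: gamma_gt; lra. Qed.
Let s_le2 : s <= 2. Proof. by rewrite /s; move: gamma_le; lra. Qed.
Let beta1 : normc beta < 1. Proof. by rewrite -unit_diskE. Qed.

Let q xi := 1 - xi^*%C * psi1 beta xi.

Let Re_realM (d : R) z : Re (d%:C * z) = d * Re z.
Proof. by rewrite Re_mulc mul0r subr0. Qed.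

Let Im_realM (d : R) z : Im (d%:C * z) = d * Im z.
Proof. by rewrite Im_mulc mul0r addr0. Qed.

Let norm2 xi : (normc xi ^+ 2)%:C = xi * xi^*%C.
Proof.
rewrite normc_sqr; case: xi => x y; apply/eqP; rewrite eq_complex /=.
by apply/andP; split; apply/eqP; ring.
Qed.

(** The last two terms are a number minus its conjugate, so the right-hand side has real part 1 -
    |xi|^2. *)
Let qE xi : unit_disk xi -> q xi * (1 - beta^*%C * xi) =
  (1 - normc xi ^+ 2)%:C - beta^*%C * xi + xi^*%C * beta.
Proof.
move=> Dxi; have d0 : 1 - beta^*%C * xi != 0.
  rewrite -normc_gt0; apply: normc_one_minus_gt0.
  by apply: normc_mul_lt1; rewrite ?normc_conj -unit_diskE.
by rewrite rmorphB rmorph1 /= norm2 /q /psi1; field.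
Qed.

Let q_Re xi : unit_disk xi -> 0 < Re (q xi).
Proof.
move=> Dxi; have := psi1_disk Dbeta Dxi; rewrite unit_diskE => p1.
have : normc (xi^*%C * psi1 beta xi) < 1.
  by apply: normc_mul_lt1; rewrite ?normc_conj // -unit_diskE.
have := norm_Re_le (xi^*%C * psi1 beta xi); rewrite ler_norml => /andP[_ h] h1.
by rewrite /q ReD ReN /= subr_gt0; apply: le_lt_trans h h1.
Qed.

Let one_sub_gt0 xi : unit_disk xi -> 0 < 1 - normc xi ^+ 2.
Proof.
by rewrite unit_diskE => xi1; rewrite subr_gt0 expr_lt1 ?normc_ge0.
Qed.

Lemma berezin_real_lower xi : unit_disk xi -> Im (Ber xi) = 0 ->
  c0 * (1 - normc beta) `^ s <= Re (Ber xi).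
Proof.
move=> Dxi; rewrite berezin_psi1E // -/(q xi) -/s -/c0.
have x0 := one_sub_gt0 Dxi; have q0 := q_Re Dxi.
set x := 1 - normc xi ^+ 2 in x0 *.
have A0 : 0 < c0 * x `^ s by rewrite mulr_gt0 // powR_gt0.
rewrite Im_realM Re_realM => /eqP; rewrite mulf_eq0 (gt_eqF A0) => /eqP I0.
have Iq : Im (q xi) = 0 by apply: Im_npow_eq0 I0; rewrite ?s_gt0.
have qr : q xi = (Re (q xi))%:C by rewrite -[LHS]cplx_eta Iq.
rewrite qr npow_pos_real // [Re _%:C]/=.
rewrite powRN -mulrA ler_pM2l //.
(* Real parts in [qE], with q real; conj(beta) xi and conj(xi) beta are conjugate and share their
   real part. *)
have e : Re (q xi) * (1 - Re (xi^*%C * beta)) = x.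
  have := congr1 (@Re R) (qE Dxi).
  rewrite qr -/x; case: (xi) (beta) => a b [c d] /=; lra.
have u1 : Re (xi^*%C * beta) <= normc beta.
  apply: le_trans (ler_norm _) _; apply: le_trans (norm_Re_le _) _.
  rewrite normcM normc_conj ler_piMl ?normc_ge0 // ltW // -unit_diskE //.
have b1 := beta1.
have u2 : 0 <= 1 - Re (xi^*%C * beta) by lra.
rewrite -e powRM ?(ltW q0) // mulrAC divff ?gt_eqF ?powR_gt0 // mul1r.
apply: ge0_ler_powR; rewrite ?nnegrE ?(ltW s_gt0) //; lra.
Qed.

Hypothesis beta0 : beta != 0.

Let b := normc beta.
Let b0 : 0 < b. Proof. by rewrite /b normc_gt0. Qed.
(** Close enough to 1 for 1 - t^2 < t b (1 - b): indeed 1 - t^2 <= 2 (1 - t) = b (1 - b) / 4,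
    whereas t >= 1/2 makes the right-hand side at least b (1 - b) / 2. *)
Let t : R := 1 - b * (1 - b) / 8.
Let xi0 : C := (t / b)%:C * 'i%C * beta.

Let t_bounds : [/\ 2^-1 <= t, t < 1 & 1 - t ^+ 2 < t * b * (1 - b)].
Proof.
have b1 : b < 1 by [].
have bb : 0 < b * (1 - b) by rewrite mulr_gt0 // subr_gt0.
have bb1 : b * (1 - b) <= 1.
  by rewrite mulr_ile1 ?(ltW b0) ?(ltW b1) // ?subr_ge0 ?(ltW b1) // gerBl ltW.
have t1 : 2^-1 <= t by rewrite /t; lra.
have t2 : t < 1 by rewrite /t; lra.
split => //.
have : 1 - t ^+ 2 <= b * (1 - b) / 4.
  have -> : 1 - t ^+ 2 = (1 - t) * (1 + t) by ring.
  have -> : 1 - t = b * (1 - b) / 8 by rewrite /t; ring.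
  have : b * (1 - b) / 8 * (1 + t) <= b * (1 - b) / 8 * 2.
    by rewrite ler_pM2l ?divr_gt0 //; lra.
  lra.
have : 2^-1 * (b * (1 - b)) <= t * (b * (1 - b)) by rewrite ler_pM2r.
rewrite -mulrA; lra.
Qed.

Let normi : normc ('i%C : C) = 1.
Proof. by rewrite /ComplexField.Normc.normc expr0n add0r expr1n sqrtr1. Qed.

Let norm_xi0 : normc xi0 = t.
Proof.
have [t1 _ _] := t_bounds; have t0 : 0 < t by lra.
rewrite /xi0 !normcM normi normc_real mulr1 ger0_norm ?divr_ge0 ?ltW //.
by rewrite -/b divfK // gt_eqF.
Qed.

Let D0 : unit_disk xi0.
Proof. by rewrite unit_diskE norm_xi0; have [] := t_bounds. Qed.

Let DN0 : unit_disk (- xi0).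
Proof. by rewrite unit_diskE normc_opp -unit_diskE. Qed.

Let beta_xi0 : beta^*%C * xi0 = (t * b)%:C * 'i%C.
Proof.
have -> : beta^*%C * xi0 = (t / b)%:C * (beta * beta^*%C) * 'i%C.
  by rewrite /xi0; ring.
rewrite -norm2 -rmorphM /=; congr (_%:C * _).
by rewrite -/b; field; exact: lt0r_neq0.
Qed.

Let xi0_beta : xi0^*%C * beta = - ((t * b)%:C * 'i%C).
Proof.
have := congr1 (@conjc R) beta_xi0; rewrite !conjcM conjcK conjc_real mulrC => ->.
by apply/eqP; rewrite eq_complex /=; apply/andP; split; apply/eqP; ring.
Qed.

Let berezin_small : normc (Ber xi0) < c0 * (1 - b) `^ s.
Proof.
have [t1 t2 t3] := t_bounds.
rewrite berezin_psi1E // -/(q xi0) -/s -/c0 normcM normc_real.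
have x0 : 0 < 1 - t ^+ 2 by have := one_sub_gt0 D0; rewrite norm_xi0.
have tb0 : 0 < t * b by rewrite mulr_gt0 //; lra.
have b1 : b < 1 by [].
rewrite norm_xi0 ger0_norm; last by rewrite mulr_ge0 ?powR_ge0 // ltW.
(* In [qE] the right-hand side is 1 - t^2 - 2 i t b, of modulus at least 2 t b, and the factor 1 - i
   t b has modulus at most 2. *)
have qn : t * b <= normc (q xi0).
  have := congr1 (@ComplexField.Normc.normc R) (qE D0); 
    rewrite normcM norm_xi0 beta_xi0 xi0_beta.
  set z := _ - _ + _ => E.
  have h1 : 2 * (t * b) <= normc z.
    apply: le_trans (norm_Im_le _); rewrite /z /=.
    have -> : 0 - (t * b * 1 + 0 * 0) - (t * b * 1 + 0 * 0) = - (2 * (t * b)).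
      by ring.
    by rewrite normrN ger0_norm // mulr_ge0 // ltW.
  have h2 : normc (1 - (t * b)%:C * 'i%C : C) <= 2.
    apply: le_trans (ler_normcB _ _) _.
    rewrite ComplexField.Normc.normc1 normcM normi normc_real mulr1.
    rewrite ger0_norm ?(ltW tb0) //.
    have : t * b <= 1 by rewrite mulr_ile1 ?(ltW b0) ?(ltW b1) ?(ltW t2) //; lra.
    lra.
  have : normc (q xi0) * normc (1 - (t * b)%:C * 'i%C : C) <= normc (q xi0) * 2.
    by rewrite ler_wpM2l ?normc_ge0.
  by rewrite E; lra.
have q0 : 0 < normc (q xi0) by apply: lt_le_trans qn.
rewrite normc_npow_powR -?normc_gt0 // powRN -mulrA ltr_pM2l //.
have b2 : 0 <= 1 - b by rewrite subr_ge0 ltW.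
rewrite ltr_pdivrMr ?powR_gt0 // -powRM ?(ltW q0) //.
apply: gt0_ltr_powR; rewrite ?nnegrE ?(mulr_ge0 b2) ?(ltW q0) ?(ltW x0) //.
by apply: lt_le_trans t3 _; rewrite mulrC ler_wpM2l.
Qed.

(** As conj(beta) xi0 is imaginary, changing the sign of [xi0] conjugates both the denominator and
    the right-hand side of [qE], hence q, and [npow] commutes with conjugation. *)
Let berezin_conj : Ber (- xi0) = (Ber xi0)^*%C.
Proof.
rewrite !berezin_psi1E // normc_opp conjcM conjc_real -npow_conj.
congr (_ * npow _ _).
rewrite -/(q _) -/(q _).
have d0 : 1 - beta^*%C * - xi0 != 0.
  rewrite -normc_gt0; apply: normc_one_minus_gt0.
  by apply: normc_mul_lt1; rewrite ?normc_conj -?unit_diskE.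
apply: (mulIf d0); rewrite qE // normc_opp.
have -> : 1 - beta^*%C * - xi0 = (1 - beta^*%C * xi0)^*%C.
  rewrite mulrN beta_xi0.
  by apply/eqP; rewrite eq_complex /=; apply/andP; split; apply/eqP; ring.
rewrite -conjcM qE // mulrN (rmorphN conjc) mulNr /= beta_xi0 xi0_beta.
by apply/eqP; rewrite eq_complex /=; apply/andP; split; apply/eqP; ring.
Qed.

Lemma berezin_range_not_convex :
  ~ cconvex (berezin_range (composition_operator gamma (psi1 beta))).
Proof.
move=> cv.
have h0 : 0 <= 2^-1 :> R by rewrite invr_ge0.
have h1 : 2^-1 <= 1 :> R by lra.
have m1 : berezin_range (composition_operator gamma (psi1 beta)) (Ber xi0).
  by exists xi0.
have m2 : berezin_range (composition_operator gamma (psi1 beta)) (Ber xi0)^*%C.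
  by rewrite -berezin_conj; exists (- xi0).
have := cv _ _ (Itv01 h0 h1) (mem_set m1) (mem_set m2).
rewrite inE => -[xi Dxi E].
(* Scaling in the real module [Rcomplex] is rewritten as complex multiplication by real numbers. *)
have {}E : Ber xi = (2^-1)%:C * Ber xi0 + (1 - 2^-1)%:C * (Ber xi0)^*%C.
  rewrite E; move: (Ber xi0) => [x y].
  by apply/eqP; rewrite eq_complex /= !mul0r !subr0 !addr0 !eqxx.
have {}E : Ber xi = (Re (Ber xi0))%:C.
  rewrite E; move: (Ber xi0) => [x y].
  by apply/eqP; rewrite eq_complex /=; apply/andP; split; apply/eqP; field.
have := berezin_real_lower Dxi; rewrite E => /(_ erefl).
rewrite leNgt => /negP; apply; apply: le_lt_trans berezin_small.
exact: le_trans (ler_norm (Re (Ber xi0))) (norm_Re_le _).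
Qed.

End range.

Theorem corollary4p8 (R : realType) (gamma : R) (beta : R[i]) :
  -1 < gamma -> gamma <= 0 -> unit_disk beta ->
  cconvex (berezin_range (composition_operator gamma (psi1 beta))) <->
  beta = 0.
Proof.
move=> gamma_gt gamma_le Dbeta; split => [cv|beta0].
  have [//|b0] := eqVneq beta 0.
  by have := berezin_range_not_convex gamma_gt gamma_le Dbeta b0 cv.
(* For beta = 0 the map is the identity and q = 1 - |xi|^2 is real: the two powers cancel, and the
   range is a single point. *)
have cst xi : unit_disk xi ->
    berezin_transform (composition_operator gamma (psi1 beta)) xi =
    (total_mass gamma)%:C.
  move=> Dxi; rewrite berezin_psi1E // beta0 /psi1.
  have -> : (0 : R[i])^*%C = 0 by exact: conjc0.
  rewrite mul0r !subr0 divr1.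
  have x0 : 0 < 1 - normc xi ^+ 2.
    by rewrite subr_gt0 expr_lt1 ?normc_ge0 // -unit_diskE.
  have -> : 1 - xi^*%C * xi = (1 - normc xi ^+ 2)%:C.
    rewrite normc_sqr; case: (xi) => x y; apply/eqP; rewrite eq_complex /=.
    by apply/andP; split; apply/eqP; ring.
  rewrite npow_pos_real // powRN -rmorphM /= -mulrA divff ?mulr1 //.
  by rewrite gt_eqF // powR_gt0.
move=> x y l; rewrite !inE => -[xi Dxi <-] [zeta Dzeta <-].
by exists xi => //; rewrite !cst // convmm.
Qed.
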